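(* Let $f_0:\mathbb R\to[0,\infty)$ be a two-peaked distribution function with maxima at $a$ and $b$ and minimum at $c$ as described in the context, let $\varphi=f_0'$, and let $k\in\mathbb R\setminus\{0\}$ be such that every zero $s$ of $\varphi$ satisfies $1-\frac1{k^2}\int_{-\infty}^{\infty}\frac{\varphi(v)}{v-s}\,dv\ne 0$. Then $N_+(k)=1$, or equivalently $\Lambda(k)\cap\{\mathrm{Re}\,\lambda>0\}\ne\varnothing$, if and only if $$\int_{-\infty}^{\infty}\frac{\varphi(v)}{v-c}\,dv\ >\ k^2 .$$
   Context: Assumptions on $f_0$: $f_0$ is twice differentiable, $f_0(v)\to 0$ as $v\to\pm\infty$, and $\varphi:=f_0'$ satisfies $\varphi\in L_1(\mathbb R)$, $\varphi(v)\to0$ as $v\to\pm\infty$, $\varphi'$ is bounded, and every zero $s$ of $\varphi$ is non-degenerate ($\varphi'(s)\neq0$). There are points $a<c<b$ and $M>0$ with $f_0(a)=f_0(b)=M$, $f_0(c)=0$, $\varphi(a)=\varphi(b)=\varphi(c)=0$, $\varphi(v)>0$ for $v\in(-\infty,a)\cup(c,b)$ and $\varphi(v)<0$ for $v\in(a,c)\cup(b,\infty)$ (so $a,b$ are the points of maximum and $c$ is the point of minimum between them). Notation: for $k\ne0$ and $\lambda\in\mathbb C\setminus i\mathbb R$, $$\Delta(k,\lambda)=1+\frac1{ik}\int_{-\infty}^{\infty}\frac{\varphi(v)}{ikv+\lambda}\,dv,\qquad \Lambda(k)=\{\lambda\in\mathbb C\setminus i\mathbb R:\ \Delta(k,\lambda)=0\},$$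 $$N_+(k)=\#\Big\{s\in\mathbb R:\ \varphi(s)=0,\ \varphi'(s)>0,\ 1-\frac1{k^2}\int_{-\infty}^{\infty}\frac{\varphi(v)}{v-s}\,dv<0\Big\}.$$ *)

(* Defs.v *)
From HB Require Import structures.
From mathcomp Require Import all_boot all_order all_algebra.
From mathcomp Require Import finmap.
From mathcomp Require Import all_classical all_reals all_analysis.
From mathcomp Require Import complex.

Set Implicit Arguments.
Unset Strict Implicit.
Unset Printing Implicit Defensive.

Import Order.TTheory GRing.Theory Num.Theory.
Import numFieldNormedType.Exports.

Local Open Scope ring_scope.
Local Open Scope complex_scope.
Local Open Scope classical_set_scope.

Section TwoPeaks.
Variable R : realType.

Record distribution_function (f0 : R -> R) : Prop := DistributionFunction {
  df_ge0 : forall v, 0 <= f0 v ;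
  df_derivable : forall v, derivable f0 v 1 ;
  df_derivable2 : forall v, derivable f0^`() v 1 ;
  df_cvg_pinfty : f0 v @[v --> +oo%R] --> (0 : R) ;
  df_cvg_ninfty : f0 v @[v --> -oo%R] --> (0 : R) ;
  df_phi_L1 : (@lebesgue_measure R).-integrable setT (EFin \o f0^`()) ;
  df_phi_cvg_pinfty : f0^`() v @[v --> +oo%R] --> (0 : R) ;
  df_phi_cvg_ninfty : f0^`() v @[v --> -oo%R] --> (0 : R) ;
  df_dphi_bounded : exists C : R, forall v, `|f0^`()^`() v| <= C ;
  df_nondegenerate : forall s, f0^`() s = 0 -> f0^`()^`() s != 0
}.

Record two_peaked (f0 : R -> R) (a c b M : R) : Prop := TwoPeaked {
  tp_lt_ac : a < c ;
  tp_lt_cb : c < b ;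
  tp_M_gt0 : 0 < M ;
  tp_f0a : f0 a = M ;
  tp_f0b : f0 b = M ;
  tp_f0c : f0 c = 0 ;
  tp_phia : f0^`() a = 0 ;
  tp_phib : f0^`() b = 0 ;
  tp_phic : f0^`() c = 0 ;
  tp_phi_gt0 : forall v, v < a \/ c < v < b -> 0 < f0^`() v ;
  tp_phi_lt0 : forall v, a < v < c \/ b < v -> f0^`() v < 0
}.

Definition integralC (f : R -> R[i]) : R[i] :=
  (\int[lebesgue_measure]_v complex.Re (f v)) +i*
  (\int[lebesgue_measure]_v complex.Im (f v)).

Definition Delta (phi : R -> R) (k : R) (lambda : R[i]) : R[i] :=
  1 + ('i%C * k%:C)^-1 *
      integralC (fun v => (phi v)%:C / ('i%C * k%:C * v%:C + lambda)).

(* lambda lies off the imaginary axis i R iff its real part is nonzero *)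
Definition Lambda (phi : R -> R) (k : R) : set R[i] :=
  [set lambda | complex.Re lambda != 0 /\ Delta phi k lambda = 0].

(* Used only at zeros s of phi = f0', where boundedness of phi' makes the
   integrand bounded near s, so that this is an absolutely convergent
   Lebesgue integral and no principal value is needed. *)
Definition penrose (phi : R -> R) (k s : R) : R :=
  1 - (k ^+ 2)^-1 * \int[lebesgue_measure]_v (phi v / (v - s)).

(* fset_set sends an infinite set to the empty one; for a two-peaked f0 the
   sign conditions leave only the zeros a, b, c of phi = f0', so the set
   counted is finite. *)
Definition Nplus (phi : R -> R) (k : R) : nat :=
  #|` fset_set [set s : R | [/\ phi s = 0, 0 < phi^`() s & penrose phi k s < 0]]|.

End TwoPeaks.

(* Main.v *)
(* Put Z(z) = int phi(v) / (v - z) dv.  For Re lambda > 0 the equation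
   Delta(k, lambda) = 0 becomes Z(z) = k^2 for a point z of the upper half
   plane, and since c is the only zero of phi with phi' > 0, both claims reduce
   to: Z(z) = t has a solution if and only if t < Z(c), where t = k^2 and
   Z(s) = int phi(v) / (v - s) dv at a real zero s of phi.

   The sign pattern of phi says exactly phi(v) (v - a) (v - c) (v - b) <= 0.
   Let Z(z) = t > 0 and Q = int phi(v) / ((v - c) |v - z|^2) dv.  Dividing the
   sign condition by (v - c)^2 |v - z|^2 and integrating gives
   t <= (c - a) (b - c) Q, while Z(c) = t + |z - c|^2 Q; hence t < Z(c), and z
   stays in a bounded set.  Dividing by |v - z|^4 instead shows Z'(z) <> 0.

   Conversely let t < Z(c).  Im Z changes sign near c, so it vanishes at some
   z1 close to c, where t1 = Z(z1) lies in ]t, Z(c)[.  The set where Im Z = 0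
   and t <= Z <= t1 is compact: near a real point with phi <> 0 the sign of
   Im Z is that of phi, and near a zero s of phi the condition Im Z = 0 forces
   Z to be close to Z(s), which is excluded as Z(a), Z(b) <= 0 (because
   f0(a) = f0(b)) and t1 < Z(c).  At a point minimising Z on this set Z = t,
   since Z' <> 0 would otherwise allow Z to be decreased along Im Z = 0. *)
Require Import Defs.
From mathcomp Require Import all_boot all_order all_algebra.
From mathcomp Require Import all_classical all_reals all_analysis.
From mathcomp Require Import measurable_realfun complex.
From mathcomp Require Import ring lra.
Import Order.TTheory GRing.Theory Num.Theory.
Import numFieldNormedType.Exports.
Local Open Scope ring_scope.
Local Open Scope classical_set_scope.

Set Implicit Arguments.
Unset Strict Implicit.

(** * Real-valued Lebesgue integrals on the line *)

Section RealIntegrals.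
Context {R : realType}.
Notation mu := (@lebesgue_measure R).
Notation integrable f := (mu.-integrable setT (EFin \o f)).
Implicit Types f g u : R -> R.

Lemma integrable_addr f g : integrable f -> integrable g ->
  integrable (fun v => f v + g v).
Proof. by move=> fi gi; exact: (@integrableD _ _ _ mu setT measurableT _ _ fi gi). Qed.

Lemma integrable_scaler r f : integrable f -> integrable (fun v => r * f v).
Proof. by move=> fi; exact: (@integrableZl _ _ _ mu setT measurableT r _ fi). Qed.

Lemma integrable_normr f : integrable f -> integrable (fun v => `|f v|).
Proof. by move=> fi; exact: (integrable_norm fi). Qed.

Lemma integrable_mulr f u C : integrable f -> measurable_fun setT u ->
  (forall v, `|u v| <= C) -> integrable (fun v => f v * u v).
Proof.
move=> fi mu_ uC; have /= := @integrableMl _ _ _ mu setT measurableT _ u fi mu_.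
apply; exists C; split; first exact: num_real.
by move=> x Cx v _ /=; apply: le_trans (uC v) (ltW Cx).
Qed.

Lemma Rintegral_add f g : integrable f -> integrable g ->
  \int[mu]_v (f v + g v) = \int[mu]_v f v + \int[mu]_v g v.
Proof. by move=> fi gi; rewrite RintegralD. Qed.

Lemma Rintegral_scale r f : integrable f ->
  \int[mu]_v (r * f v) = r * \int[mu]_v f v.
Proof. by move=> fi; rewrite RintegralZl. Qed.

Lemma ler_Rintegral f g : integrable f -> integrable g ->
  (forall v, f v <= g v) -> \int[mu]_v f v <= \int[mu]_v g v.
Proof. by move=> fi gi fg; apply: le_Rintegral => // v _; exact: fg. Qed.

Lemma Rintegral_le0 f : integrable f -> (forall v, f v <= 0) ->
  \int[mu]_v f v <= 0.
Proof.
move=> fi f0; have := ler_Rintegral fi (integrable_scaler 0 fi).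
by rewrite Rintegral_scale// mul0r; apply => v; rewrite mul0r.
Qed.

Lemma ler_norm_Rintegral f g : integrable f -> integrable g ->
  (forall v, `|f v| <= g v) -> `|\int[mu]_v f v| <= \int[mu]_v g v.
Proof.
move=> fi gi fg; apply: le_trans (le_normr_Rintegral _ fi) _ => //.
exact: ler_Rintegral (integrable_normr fi) gi fg.
Qed.

(** Serves to integrate partial-fraction identities, which involve at most four kernels; shorter
    combinations take coefficient 0. *)
Lemma Rintegral_lin4 f1 f2 f3 f4 (r2 r3 r4 : R) : integrable f1 -> integrable f2 ->
  integrable f3 -> integrable f4 ->
  integrable (fun v => f1 v + r2 * f2 v + r3 * f3 v + r4 * f4 v) /\
  \int[mu]_v (f1 v + r2 * f2 v + r3 * f3 v + r4 * f4 v) =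
  \int[mu]_v f1 v + r2 * \int[mu]_v f2 v + r3 * \int[mu]_v f3 v + r4 * \int[mu]_v f4 v.
Proof.
move=> i1 i2 i3 i4.
have j2 := integrable_scaler r2 i2; have j3 := integrable_scaler r3 i3.
have j4 := integrable_scaler r4 i4.
have k2 := integrable_addr i1 j2; have k3 := integrable_addr k2 j3.
split; first exact: integrable_addr k3 j4.
by rewrite (Rintegral_add k3 j4) (Rintegral_add k2 j3) (Rintegral_add i1 j2) !Rintegral_scale.
Qed.

Lemma integrable_indic_segment (x y : R) : integrable (\1_`[x, y]).
Proof. exact: (integrable_indic_itv x y true false). Qed.

Lemma Rintegral_indic_segment (x y : R) : x <= y ->
  \int[mu]_v (\1_`[x, y] v : R) = y - x.
Proof.
move=> xy; rewrite /Rintegral integral_indic// setIT.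
transitivity (fine (if x < y then (y - x)%:E else 0%E)).
  by congr fine; rewrite [LHS](lebesgue_measure_itv `[x, y]%R) /= lte_fin EFinB.
case: ltP => //= yx.
by apply/esym/eqP; rewrite subr_eq0 eq_le xy yx.
Qed.

Lemma measurable_invr_sub (s : R) : measurable_fun setT (fun v : R => (v - s)^-1).
Proof.
have -> : [set: R] = ~` [set s] `|` [set s] by rewrite setUC setUCr.
apply/measurable_funU => //; first exact: measurableC.
split; last exact: measurable_fun_set1.
apply: open_continuous_measurable_fun.
  by apply: closed_openC; apply: accessible_closed_set1; apply: hausdorff_accessible; apply: Rhausdorff.
move=> v; rewrite inE/= => /eqP vs.
apply: (@continuousV R R (fun v => v - s)); first by rewrite subr_eq0.
by apply: continuousB; [exact: cvg_id|exact: cvg_cst].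
Qed.

End RealIntegrals.

(** * The Cauchy kernel in the upper half plane: measurability, bounds, first-order expansion *)

Section CauchyKernel.
Context {R : realType}.
Implicit Types x y v s : R.

(* For [z = x + i y] these are the real and imaginary parts of [1 / (v - z)]
   and of its derivative [1 / (v - z)^2] in [z]. *)
Definition kre x y v := (v - x) / ((v - x) ^+ 2 + y ^+ 2).
Definition kim x y v := y / ((v - x) ^+ 2 + y ^+ 2).
Definition dkre x y v := ((v - x) ^+ 2 - y ^+ 2) / ((v - x) ^+ 2 + y ^+ 2) ^+ 2.
Definition dkim x y v := (2 * (v - x) * y) / ((v - x) ^+ 2 + y ^+ 2) ^+ 2.

Lemma sqdist_gt0 x y v : 0 < y -> 0 < (v - x) ^+ 2 + y ^+ 2.
Proof. by move=> y0; rewrite ltr_wpDl ?sqr_ge0// exprn_gt0. Qed.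

Lemma measurable_subr x : measurable_fun setT (fun v : R => v - x).
Proof. exact: measurable_funB. Qed.

Lemma measurable_sqdistV x y : 0 < y ->
  measurable_fun setT (fun v => ((v - x) ^+ 2 + y ^+ 2)^-1).
Proof.
move=> y0; apply: continuous_measurable_fun => v.
apply: (@continuousV R R (fun v => (v - x) ^+ 2 + y ^+ 2)).
  by rewrite gt_eqF// sqdist_gt0.
apply: continuousD; last exact: cvg_cst.
apply: (@continuous_comp _ _ _ (fun v => v - x) (fun w => w ^+ 2)).
  by apply: continuousB; [exact: cvg_id|exact: cvg_cst].
exact: exprn_continuous.
Qed.

Lemma measurable_kre x y : 0 < y -> measurable_fun setT (kre x y).
Proof.
by move=> y0; apply: measurable_funM; [exact: measurable_subr|exact: measurable_sqdistV].
Qed.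

Lemma measurable_kim x y : 0 < y -> measurable_fun setT (kim x y).
Proof.
by move=> y0; apply: measurable_funM => //; exact: measurable_sqdistV.
Qed.

Lemma measurable_sqdistVX x y : 0 < y ->
  measurable_fun setT (fun v => (((v - x) ^+ 2 + y ^+ 2) ^+ 2)^-1).
Proof.
move=> y0; under eq_fun do rewrite -exprVn.
by apply: measurable_funX; exact: measurable_sqdistV.
Qed.

Lemma measurable_dkre x y : 0 < y -> measurable_fun setT (dkre x y).
Proof.
move=> y0; apply: measurable_funM; last exact: measurable_sqdistVX.
by apply: measurable_funB => //; apply: measurable_funX; exact: measurable_subr.
Qed.

Lemma measurable_dkim x y : 0 < y -> measurable_fun setT (dkim x y).
Proof.
move=> y0; apply: measurable_funM; last exact: measurable_sqdistVX.
by do 2 apply: measurable_funM => //; exact: measurable_subr.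
Qed.

Lemma ler_sqdistV x y v : 0 < y -> ((v - x) ^+ 2 + y ^+ 2)^-1 <= (y ^+ 2)^-1.
Proof.
move=> y0; rewrite lef_pV2 ?posrE ?sqdist_gt0 ?exprn_gt0//.
by rewrite lerDr sqr_ge0.
Qed.

Lemma kre_bounded x y v : 0 < y -> `|kre x y v| <= y^-1.
Proof.
move=> y0; have D0 := sqdist_gt0 x v y0; rewrite /kre normf_div (gtr0_norm D0).
rewrite ler_pdivrMr// mulrC ler_pdivlMr//.
have <- : `|v - x| ^+ 2 = (v - x) ^+ 2 by rewrite real_normK ?num_real.
by have := sqr_ge0 (`|v - x| - y); nra.
Qed.

Lemma kim_bounded x y v : 0 < y -> `|kim x y v| <= y^-1.
Proof.
move=> y0; have D0 := sqdist_gt0 x v y0; rewrite /kim normf_div (gtr0_norm D0) (gtr0_norm y0).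
rewrite ler_pdivrMr// mulrC ler_pdivlMr//.
by rewrite -expr2 lerDr sqr_ge0.
Qed.

Lemma dkre_bounded x y v : 0 < y -> `|dkre x y v| <= (y ^+ 2)^-1.
Proof.
move=> y0; have D0 := sqdist_gt0 x v y0.
have Y0 : 0 < y ^+ 2 by rewrite exprn_gt0.
rewrite /dkre normf_div (gtr0_norm (exprn_gt0 2 D0)).
rewrite ler_pdivrMr ?exprn_gt0// [leRHS]mulrC ler_pdivlMr//.
set u := (v - x) ^+ 2 in D0 *; have u0 : 0 <= u by exact: sqr_ge0.
set w := y ^+ 2 in D0 Y0 *.
apply: (@le_trans _ _ ((u + w) * w)); last by nra.
by rewrite ler_pM2r// ler_norml; lra.
Qed.

Lemma dkim_bounded x y v : 0 < y -> `|dkim x y v| <= (y ^+ 2)^-1.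
Proof.
move=> y0; have D0 := sqdist_gt0 x v y0.
have Y0 : 0 < y ^+ 2 by rewrite exprn_gt0.
rewrite /dkim normf_div (gtr0_norm (exprn_gt0 2 D0)).
rewrite ler_pdivrMr ?exprn_gt0// [leRHS]mulrC ler_pdivlMr//.
apply: (@le_trans _ _ (((v - x) ^+ 2 + y ^+ 2) * y ^+ 2)).
  rewrite ler_pM2r// ler_norml.
  have := sqr_ge0 (v - x - y); have := sqr_ge0 (v - x + y).
  by rewrite sqrrB sqrrD; nra.
by have := sqr_ge0 (v - x); nra.
Qed.

(* [1/(u - h) - 1/u - h/u^2 = h^2 / (u^2 (u - h))] with [u = v - z]. *)
Lemma kernel_remainderE x y v h1 h2 : 0 < y -> 0 < y + h2 ->
  let D := (v - x) ^+ 2 + y ^+ 2 in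
  let E := (v - (x + h1)) ^+ 2 + (y + h2) ^+ 2 in
  let r1 := kre (x + h1) (y + h2) v - kre x y v - (h1 * dkre x y v - h2 * dkim x y v) in
  let r2 := kim (x + h1) (y + h2) v - kim x y v - (h1 * dkim x y v + h2 * dkre x y v) in
  r1 ^+ 2 + r2 ^+ 2 = (h1 ^+ 2 + h2 ^+ 2) ^+ 2 / (D ^+ 2 * E).
Proof.
move=> y0 yh D E r1 r2.
have D0 : D != 0 by rewrite gt_eqF// sqdist_gt0.
have E0 : E != 0 by rewrite gt_eqF// sqdist_gt0.
have -> : r1 = ((h1 ^+ 2 - h2 ^+ 2) * (((v - x) ^+ 2 - y ^+ 2) * (v - (x + h1)) - 2 * (v - x) * y * (y + h2))
  - 2 * h1 * h2 * (((v - x) ^+ 2 - y ^+ 2) * (y + h2) + 2 * (v - x) * y * (v - (x + h1)))) / (D ^+ 2 * E).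
  by rewrite /r1 /kre /dkre /dkim -/D -/E /D /E; field; apply/andP.
have -> : r2 = ((h1 ^+ 2 - h2 ^+ 2) * (((v - x) ^+ 2 - y ^+ 2) * (y + h2) + 2 * (v - x) * y * (v - (x + h1)))
  + 2 * h1 * h2 * (((v - x) ^+ 2 - y ^+ 2) * (v - (x + h1)) - 2 * (v - x) * y * (y + h2))) / (D ^+ 2 * E).
  by rewrite /r2 /kim /dkre /dkim -/D -/E /D /E; field; apply/andP.
by rewrite /D /E; field; apply/andP.
Qed.

(** Each component is at most the modulus given by the identity above. A shift of length at most
    [y / 2] keeps [y + h2] above [y / 2], so that [D ^+ 2 * E] is at least [y ^+ 6 / 4]. *)
Lemma kernel_remainder x y v h1 h2 : 0 < y -> h1 ^+ 2 + h2 ^+ 2 <= y ^+ 2 / 4 ->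
  `|kre (x + h1) (y + h2) v - kre x y v - (h1 * dkre x y v - h2 * dkim x y v)|
    <= (h1 ^+ 2 + h2 ^+ 2) * (2 / y ^+ 3) /\
  `|kim (x + h1) (y + h2) v - kim x y v - (h1 * dkim x y v + h2 * dkre x y v)|
    <= (h1 ^+ 2 + h2 ^+ 2) * (2 / y ^+ 3).
Proof.
move=> y0 hy.
have yh : y / 2 <= y + h2.
  rewrite leNgt; apply/negP => yh; have := sqr_ge0 h1; nra.
have yh0 : 0 < y + h2 by apply: lt_le_trans yh; rewrite divr_gt0.
have := kernel_remainderE x v h1 y0 yh0 => /=.
set D := _ + y ^+ 2; set E := _ + (y + h2) ^+ 2.
set r1 := kre _ _ _ - _ - _; set r2 := kim _ _ _ - _ - _ => rE.
set h := _ + h2 ^+ 2 in hy rE *.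
have h0 : 0 <= h by rewrite addr_ge0 ?sqr_ge0.
have Y0 : 0 < y ^+ 2 by rewrite exprn_gt0.
have DY : y ^+ 2 <= D by rewrite /D lerDr sqr_ge0.
have EY : y ^+ 2 / 4 <= E.
  by rewrite /E; have := sqr_ge0 (v - (x + h1)); nra.
have DE : y ^+ 6 / 4 <= D ^+ 2 * E.
  have -> : y ^+ 6 / 4 = (y ^+ 2) ^+ 2 * (y ^+ 2 / 4) by field.
  apply: ler_pM EY; rewrite ?sqr_ge0 ?divr_ge0 ?(ltW Y0)//.
  by rewrite ler_sqr// nnegrE ?(ltW Y0)// (le_trans (ltW Y0)).
have rb : r1 ^+ 2 + r2 ^+ 2 <= (h * (2 / y ^+ 3)) ^+ 2.
  rewrite rE ler_pdivrMr; last by apply: lt_le_trans DE; rewrite divr_gt0 ?exprn_gt0.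
  have -> : h ^+ 2 = (h * (2 / y ^+ 3)) ^+ 2 * (y ^+ 6 / 4).
    by field; rewrite gt_eqF.
  by rewrite ler_wpM2l ?sqr_ge0.
have B0 : 0 <= h * (2 / y ^+ 3) by rewrite mulr_ge0// divr_ge0// exprn_ge0 ?ltW.
by split; rewrite -ler_sqr ?nnegrE// real_normK ?num_real//; apply: le_trans rb;
  rewrite ?lerDl ?lerDr sqr_ge0.
Qed.

End CauchyKernel.

(** * The Cauchy transform Z in the upper half plane: expansion and continuity *)

Section CauchyTransform.
Context {R : realType}.
Notation mu := (@lebesgue_measure R).
Notation integrable f := (mu.-integrable setT (EFin \o f)).
Variable phi : R -> R.
Hypothesis phi_int : integrable phi.
Implicit Types x y v s : R.

(* Real and imaginary parts of [Z z = int phi v / (v - z) dv], [z = x + i y],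
   and of its derivative [Z' z]. *)
Definition cre x y := \int[mu]_v (phi v * kre x y v).
Definition cim x y := \int[mu]_v (phi v * kim x y v).
Definition dcre x y := \int[mu]_v (phi v * dkre x y v).
Definition dcim x y := \int[mu]_v (phi v * dkim x y v).

Lemma integrable_kre x y : 0 < y -> integrable (fun v => phi v * kre x y v).
Proof.
move=> y0; apply: integrable_mulr phi_int (measurable_kre x y0) (fun v => kre_bounded x v y0).
Qed.

Lemma integrable_kim x y : 0 < y -> integrable (fun v => phi v * kim x y v).
Proof.
move=> y0; apply: integrable_mulr phi_int (measurable_kim x y0) (fun v => kim_bounded x v y0).
Qed.

Lemma integrable_dkre x y : 0 < y -> integrable (fun v => phi v * dkre x y v).
Proof.
move=> y0; apply: integrable_mulr phi_int (measurable_dkre x y0) (fun v => dkre_bounded x v y0).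
Qed.

Lemma integrable_dkim x y : 0 < y -> integrable (fun v => phi v * dkim x y v).
Proof.
move=> y0; apply: integrable_mulr phi_int (measurable_dkim x y0) (fun v => dkim_bounded x v y0).
Qed.

(** Integrating the kernel remainder against [phi] yields Z(z + h) = Z(z) + h Z'(z) + O(|h|^2) with
    an explicit constant, split into real and imaginary parts. *)
Lemma cauchy_expansion x y h1 h2 : 0 < y -> h1 ^+ 2 + h2 ^+ 2 <= y ^+ 2 / 4 ->
  let K := 2 / y ^+ 3 * \int[mu]_v `|phi v| in
  `|cre (x + h1) (y + h2) - cre x y - (h1 * dcre x y - h2 * dcim x y)|
    <= K * (h1 ^+ 2 + h2 ^+ 2) /\
  `|cim (x + h1) (y + h2) - cim x y - (h1 * dcim x y + h2 * dcre x y)|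
    <= K * (h1 ^+ 2 + h2 ^+ 2).
Proof.
move=> y0 hy K.
have yh : 0 < y + h2.
  by rewrite ltNge; apply/negP => yh; have := sqr_ge0 h1; nra.
have ni := integrable_normr phi_int.
have -> : K * (h1 ^+ 2 + h2 ^+ 2) =
    \int[mu]_v ((h1 ^+ 2 + h2 ^+ 2) * (2 / y ^+ 3) * `|phi v|).
  by rewrite Rintegral_scale// /K; ring.
have ki := integrable_scaler ((h1 ^+ 2 + h2 ^+ 2) * (2 / y ^+ 3)) ni.
split.
- have [i4 e4] := @Rintegral_lin4 _ _ _ _ _ (-1) (- h1) h2
    (integrable_kre (x + h1) yh) (integrable_kre x y0)
    (integrable_dkre x y0) (integrable_dkim x y0).
  rewrite (_ : _ - _ - _ = \int[mu]_v (phi v * kre (x + h1) (y + h2) v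
      + -1 * (phi v * kre x y v) + (- h1) * (phi v * dkre x y v) + h2 * (phi v * dkim x y v))).
    2: by rewrite e4 /cre /dcre /dcim; ring.
  apply: (ler_norm_Rintegral i4 ki) => v.
  have [E _] := kernel_remainder x v y0 hy.
  rewrite [leRHS]mulrC; apply: le_trans (ler_wpM2l (normr_ge0 (phi v)) E).
  by rewrite -normrM le_eqVlt; apply/orP; left; apply/eqP; congr (`|_|); ring.
- have [i4 e4] := @Rintegral_lin4 _ _ _ _ _ (-1) (- h1) (- h2)
    (integrable_kim (x + h1) yh) (integrable_kim x y0)
    (integrable_dkim x y0) (integrable_dkre x y0).
  rewrite (_ : _ - _ - _ = \int[mu]_v (phi v * kim (x + h1) (y + h2) v
      + -1 * (phi v * kim x y v) + (- h1) * (phi v * dkim x y v) + (- h2) * (phi v * dkre x y v))).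
    2: by rewrite e4 /cim /dcre /dcim; ring.
  apply: (ler_norm_Rintegral i4 ki) => v.
  have [_ E] := kernel_remainder x v y0 hy.
  rewrite [leRHS]mulrC; apply: le_trans (ler_wpM2l (normr_ge0 (phi v)) E).
  by rewrite -normrM le_eqVlt; apply/orP; left; apply/eqP; congr (`|_|); ring.
Qed.

Lemma continuous_at_pair (f : R -> R -> R) x y r C : 0 < r ->
  (forall h1 h2, `|h1| <= r -> `|h2| <= r ->
     `|f (x + h1) (y + h2) - f x y| <= C * (`|h1| + `|h2|)) ->
  {for (x, y), continuous (fun z : R * R => f z.1 z.2)}.
Proof.
move=> r0 fC; apply/cvgrPdist_le => e e0.
(* Using [|C| + 1] keeps the denominator positive whatever the sign of [C]. *)
pose d := Num.min r (e / (2 * (`|C| + 1))).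
have C1 : 0 < `|C| + 1 by rewrite ltr_wpDl.
have d0 : 0 < d by rewrite lt_min r0 divr_gt0// mulr_gt0.
have dC : 2 * (`|C| + 1) * d <= e.
  by rewrite mulrC -ler_pdivlMr ?mulr_gt0// ge_min lexx orbT.
exists (ball x d, ball y d) => /=; first by split; exact: nbhsx_ballx.
move=> -[z1 z2] [/= b1 b2].
rewrite distrC.
have h1 : `|z1 - x| < d by rewrite distrC.
have h2 : `|z2 - y| < d by rewrite distrC.
have dr : d <= r by rewrite ge_min lexx.
have := fC (z1 - x) (z2 - y) (ltW (lt_le_trans h1 dr)) (ltW (lt_le_trans h2 dr)).
rewrite !subrKC => /le_trans; apply; apply: le_trans dC.
have := ler_norm C; have := normr_ge0 (z1 - x); have := normr_ge0 (z2 - y); nra.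
Qed.

Lemma continuous_cauchy x y : 0 < y ->
  {for (x, y), continuous (fun z : R * R => cre z.1 z.2)} /\
  {for (x, y), continuous (fun z : R * R => cim z.1 z.2)}.
Proof.
(* The bound [y / 4] makes the expansion applicable; the bound 1 lets the quadratic remainder be
   absorbed into [|h1| + |h2|]. *)
move=> y0; pose r := Num.min 1 (y / 4).
have r0 : 0 < r by rewrite lt_min ltr01 divr_gt0.
have r1 : r <= 1 by rewrite ge_min lexx.
have ry : r <= y / 4 by rewrite ge_min lexx orbT.
pose K := 2 / y ^+ 3 * \int[mu]_v `|phi v|.
have K0 : 0 <= K.
  apply: mulr_ge0; first by rewrite divr_ge0 ?exprn_ge0 ?(ltW y0).
  by apply: Rintegral_ge0 => v _; exact: normr_ge0.
have ex h1 h2 : `|h1| <= r -> `|h2| <= r ->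
    [/\ h1 ^+ 2 + h2 ^+ 2 <= y ^+ 2 / 4, h1 ^+ 2 <= `|h1| & h2 ^+ 2 <= `|h2|].
  rewrite -(real_normK (num_real h1)) -(real_normK (num_real h2)).
  move: (normr_ge0 h1) (normr_ge0 h2) => a1 a2 b1 b2.
  by split; nra.
split; apply: (continuous_at_pair (r := r) (C := `|dcre x y| + `|dcim x y| + K)) => //.
- move=> h1 h2 b1 b2; have [hy l1 l2] := ex _ _ b1 b2.
  have [+ _] := cauchy_expansion x y0 hy; rewrite -/K => E.
  rewrite -[X in `|X|](subrK (h1 * dcre x y - h2 * dcim x y)).
  apply: le_trans (ler_normD _ _) _.
  have := ler_normB (h1 * dcre x y) (h2 * dcim x y); rewrite !normrM.
  move: E; set n1 := `|_ - (_ - _)|; set n2 := `|_ - _|.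
  have := normr_ge0 (dcre x y); have := normr_ge0 (dcim x y).
  have := normr_ge0 h1; have := normr_ge0 h2; nra.
- move=> h1 h2 b1 b2; have [hy l1 l2] := ex _ _ b1 b2.
  have [_ +] := cauchy_expansion x y0 hy; rewrite -/K => E.
  rewrite -[X in `|X|](subrK (h1 * dcim x y + h2 * dcre x y)).
  apply: le_trans (ler_normD _ _) _.
  have := ler_normD (h1 * dcim x y) (h2 * dcre x y); rewrite !normrM.
  move: E; set n1 := `|_ - (_ + _)|; set n2 := `|_ + _|.
  have := normr_ge0 (dcre x y); have := normr_ge0 (dcim x y).
  have := normr_ge0 h1; have := normr_ge0 h2; nra.
Qed.

End CauchyTransform.

(** * Behaviour of Z near the real axis *)

Section BoundaryBehaviour.
Context {R : realType}.
Notation mu := (@lebesgue_measure R).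
Notation integrable f := (mu.-integrable setT (EFin \o f)).
Variable phi : R -> R.
Hypothesis phi_int : integrable phi.
Implicit Types x y v s : R.

(** Up to a factor pi, [kim] is the Poisson kernel. On [[x, x + y]] it is at least [1 / (2 y)] and
    [phi] at least [m], which contributes [m / 2]; at distance at least [d] from [s] it is O(y), and
    in between the integrand is nonnegative. *)
Lemma cim_gt0_near s : {for s, continuous phi} -> 0 < phi s ->
  exists2 e, 0 < e & forall x y, `|x - s| < e -> 0 < y -> y < e -> 0 < cim phi x y.
Proof.
move=> /cvgrPdist_lt cphi phis; pose m := phi s / 2.
have m0 : 0 < m by rewrite divr_gt0.
have /nbhs_ballP[d /= d0 dm] := cphi _ m0.
have {}dm v : `|v - s| < d -> m <= phi v.
  move=> vs; have : `|phi s - phi v| < m by apply: dm; rewrite /ball/= distrC.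
  by rewrite ltr_norml => /andP[_]; rewrite /m; lra.
pose I := \int[mu]_v `|phi v|.
have I0 : 0 <= I by apply: Rintegral_ge0 => v _; exact: normr_ge0.
(* The first bound keeps [[x, x + y]] within [d] of [s] and points outside that ball at least
   [d / 2] from [x]; the second makes the far part [4 y I / d^2] smaller than [m / 2]. *)
pose e := Num.min (d / 2) (m * d ^+ 2 / (8 * (I + 1))).
have e0 : 0 < e by rewrite lt_min !divr_gt0 ?mulr_gt0 ?exprn_gt0//; lra.
have ed : e <= d / 2 by rewrite ge_min lexx.
have eI : e * (8 * (I + 1)) <= m * d ^+ 2.
  rewrite -ler_pdivlMr; first by rewrite ge_min lexx orbT.
  by rewrite mulr_gt0//; lra.
exists e => // x y xs y0 ye.
have ii := integrable_scaler (m / (2 * y)) (integrable_indic_segment x (x + y)).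
have ni := integrable_scaler (- (4 * y / d ^+ 2)) (integrable_normr phi_int).
have := ler_Rintegral (integrable_addr ii ni) (integrable_kim phi_int x y0).
rewrite (Rintegral_add ii ni) Rintegral_scale; last exact: integrable_indic_segment.
rewrite Rintegral_scale; last exact: integrable_normr.
rewrite Rintegral_indic_segment; last by lra.
rewrite -/I -/(cim phi x y) => lb.
have D2 : 0 < d ^+ 2 by rewrite exprn_gt0.
apply: lt_le_trans (lb _).
  have -> : m / (2 * y) * (x + y - x) + - (4 * y / d ^+ 2) * I
      = (m * d ^+ 2 - 8 * y * I) / (2 * d ^+ 2).
    by field; rewrite !gt_eqF.
  by rewrite divr_gt0 ?mulr_gt0//; nra.
move=> v; have Dv := sqdist_gt0 x v y0.
have k0 : 0 <= kim x y v by rewrite divr_ge0 ?ltW.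
have c0 : 0 <= 4 * y / d ^+ 2 by rewrite divr_ge0 ?ltW ?mulr_gt0.
have n0 := normr_ge0 (phi v).
have [vxy|] := boolP (v \in `[x, x + y]%classic).
- rewrite indicE vxy mulr1.
  move: vxy; rewrite inE/= in_itv/= => /andP[v1 v2].
  have vs : `|v - s| < d.
    by move: xs; rewrite !ltr_norml => /andP[? ?]; apply/andP; split; lra.
  have kb : (2 * y)^-1 <= kim x y v.
    rewrite /kim ler_pdivlMr// ler_pdivrMl ?mulr_gt0//; nra.
  have := dm _ vs; have : 0 <= 4 * y / d ^+ 2 * `|phi v| by exact: mulr_ge0.
  have : 0 < (2 * y)^-1 by rewrite invr_gt0 mulr_gt0.
  by move=> ? ? ?; rewrite mulNr; nra.
move=> /negbTE nv; rewrite indicE nv mulr0 add0r mulNr.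
have [vs|vs] := ltP `|v - s| d.
  have := dm _ vs => pv; apply: (@le_trans _ _ 0); last by rewrite mulr_ge0//; lra.
  by rewrite oppr_le0 mulr_ge0.
have kb : kim x y v <= 4 * y / d ^+ 2.
  rewrite /kim ler_pdivrMr// mulrAC ler_pdivlMr//.
  have vx : d / 2 <= `|v - x|.
    have := ler_distD x v s; lra.
  have <- : `|v - x| ^+ 2 = (v - x) ^+ 2 by rewrite real_normK ?num_real.
  suff : d ^+ 2 <= 4 * (`|v - x| ^+ 2 + y ^+ 2) by nra.
  by have := sqr_ge0 y; nra.
have := lerNnormlW (lexx `|phi v|); nra.
Qed.


Variables (s L : R).
Hypothesis phi_lip : forall v, `|phi v| <= L * `|v - s|.

Let g v := phi v / (v - s).

(** Holds at [v = s] too, since the Lipschitz bound forces [phi s = 0]. *)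
Let gM v : phi v = g v * (v - s).
Proof.
rewrite /g; have [->|vs] := eqVneq v s; last by rewrite divfK// subr_eq0.
apply/eqP; rewrite subrr mulr0 -normr_le0.
by have := phi_lip s; rewrite subrr normr0 mulr0.
Qed.

Let L_ge0 : 0 <= L.
Proof.
have := phi_lip (s + 1); rewrite addrAC subrr add0r normr1 mulr1.
exact: le_trans (normr_ge0 _).
Qed.

Lemma quotient_bounded v : `|phi v / (v - s)| <= L.
Proof.
have [->|vs] := eqVneq v s; first by rewrite subrr invr0 mulr0 normr0.
by rewrite normf_div ler_pdivrMr ?normr_gt0 ?subr_eq0.
Qed.

(** The quotient is dominated by [L] on [[s - 1, s + 1]] and by [|phi|] elsewhere. *)
Lemma integrable_quotient : integrable (fun v => phi v / (v - s)).
Proof.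
have mphi : measurable_fun setT phi by apply/measurable_EFinP; exact: (measurable_int mu phi_int).
have di := integrable_addr (integrable_scaler L (integrable_indic_segment (s - 1) (s + 1)))
  (integrable_normr phi_int).
apply: (@le_integrable _ _ _ mu setT measurableT _ _ _ _ di).
  apply/measurable_EFinP; apply: measurable_funM => //; exact: measurable_invr_sub.
move=> v _; rewrite /= lee_fin.
have L1 : 0 <= L * \1_`[s - 1, s + 1] v by rewrite mulr_ge0// indicE ler0n.
rewrite [leRHS]ger0_norm ?addr_ge0//.
have [vs|vs] := boolP (v \in `[s - 1, s + 1]%classic).
  rewrite indicE vs mulr1; apply: le_trans (quotient_bounded v) _.
  by rewrite lerDl.
apply: (@le_trans _ _ `|phi v|); last by rewrite lerDr.
have v1 : 1 <= `|v - s|.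
  move: vs; rewrite notin_setE/= in_itv/= => /negP; rewrite negb_and -!ltNge.
  by case/orP => ?; rewrite ?ler_normr; apply/orP; [right|left]; lra.
rewrite normf_div ler_pdivrMr ?(lt_le_trans ltr01)//.
by rewrite ler_peMr.
Qed.

Lemma integrable_quotient_sqdist x y : 0 < y ->
  integrable (fun v => phi v / (v - s) * ((v - x) ^+ 2 + y ^+ 2)^-1).
Proof.
move=> y0; apply: (integrable_mulr integrable_quotient (measurable_sqdistV x y0) (C := (y ^+ 2)^-1)).
move=> v; rewrite ger0_norm; first exact: ler_sqdistV.
by rewrite invr_ge0 ltW// sqdist_gt0.
Qed.

(** Integrates a pointwise partial-fraction identity. Where [cim] vanishes it reads Z(s) - Z(z) = |z
    - s|^2 int g / |v - z|^2, which compares a value at a root with the boundary value. *)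
Lemma cauchy_quotient x y : 0 < y ->
  ((x - s) ^+ 2 + y ^+ 2) * \int[mu]_v (phi v / (v - s) * ((v - x) ^+ 2 + y ^+ 2)^-1)
  = \int[mu]_v (phi v / (v - s)) - cre phi x y + (x - s) / y * cim phi x y.
Proof.
move=> y0; have [_] := Rintegral_lin4 (-1) ((x - s) / y) 0 integrable_quotient
  (integrable_kre phi_int x y0) (integrable_kim phi_int x y0) integrable_quotient.
rewrite mul0r addr0 mulN1r -/(cre phi x y) -/(cim phi x y) => <-.
rewrite -(Rintegral_scale _ (integrable_quotient_sqdist x y0)).
apply: eq_Rintegral => v _; rewrite -/(g v) (gM v) /kre /kim.
by field; rewrite !gt_eqF// sqdist_gt0.
Qed.

Variables (sg d0 : R).
Hypothesis sg1 : `|sg| = 1.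
Hypothesis d0_gt0 : 0 < d0.
Hypothesis phi_sign : forall v, `|v - s| < d0 -> 0 <= sg * phi v * (v - s).

(* On [cim = 0] the difference [w] of the two values equals both
   [int g kappa] and [- |z - s|^2 int g / |v - z|^2], where [g = phi / (v - s)]
   and [2 |kappa| <= 1 + |z - s|^2 / |v - z|^2].  As [g] has constant sign near
   [s], this bounds [2 |w|] by [|w|] plus small terms. *)
Lemma cre_cvg_root (eta : R) : 0 < eta ->
  exists2 e, 0 < e & forall x y, `|x - s| < e -> 0 < y -> y < e -> cim phi x y = 0 ->
    `|cre phi x y - \int[mu]_v (phi v / (v - s))| <= eta.
Proof.
move=> eta0; pose I := \int[mu]_v `|phi v|.
have I0 : 0 <= I by apply: Rintegral_ge0 => v _; exact: normr_ge0.
(* This [d] makes the near contribution [2 L d] at most [eta / 2]; the later [e] does the same for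
   the far contribution [12 e I / d^2]. *)
pose d := Num.min (d0 / 2) (eta / (4 * (L + 1))).
have L0 := L_ge0.
have d_gt0 : 0 < d by rewrite lt_min !divr_gt0 ?mulr_gt0//; lra.
have dd0 : d < d0.
  by apply: (@le_lt_trans _ _ (d0 / 2)); [rewrite ge_min lexx|rewrite ltr_pdivrMr// ltr_pMr// ltr1n].
have dL : d * (4 * (L + 1)) <= eta.
  rewrite -ler_pdivlMr; first by rewrite ge_min lexx orbT.
  by rewrite mulr_gt0//; lra.
have D2 : 0 < d ^+ 2 by rewrite exprn_gt0.
pose e := Num.min (d / 2) (eta * d ^+ 2 / (24 * (I + 1))).
have e0 : 0 < e by rewrite lt_min !divr_gt0 ?mulr_gt0 ?exprn_gt0//; lra.
have ed : e <= d / 2 by rewrite ge_min lexx.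
have eI : e * (24 * (I + 1)) <= eta * d ^+ 2.
  rewrite -ler_pdivlMr; first by rewrite ge_min lexx orbT.
  by rewrite mulr_gt0//; lra.
exists e => // x y xs y0 ye cim0.
pose q v := ((v - x) ^+ 2 + y ^+ 2)^-1.
pose E2 := (x - s) ^+ 2 + y ^+ 2.
pose w := cre phi x y - \int[mu]_v (phi v / (v - s)).
have wE : E2 * \int[mu]_v (phi v / (v - s) * q v) = - w.
  by rewrite cauchy_quotient// cim0 mulr0 addr0 /w opprB.
(* [kap v] is the real part of (z - s) / (v - z), that is, [(v - s) * kre x y v - 1]. *)
pose kap v := ((x - s) * (v - x) - y ^+ 2) * q v.
have gkE v : phi v * kre x y v + (-1) * (phi v / (v - s)) + 0 * (phi v / (v - s))
    + 0 * (phi v / (v - s)) = phi v / (v - s) * kap v.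
  rewrite !mul0r !addr0 -/(g v) (gM v) /kre /kap /q.
  by field; rewrite gt_eqF// sqdist_gt0.
have qi := integrable_quotient.
have [gki gkw] := Rintegral_lin4 (-1) 0 0 (integrable_kre phi_int x y0) qi qi qi.
have {}gkw : \int[mu]_v (phi v / (v - s) * kap v) = w.
  transitivity (\int[mu]_v (phi v * kre x y v + (-1) * (phi v / (v - s)) +
    0 * (phi v / (v - s)) + 0 * (phi v / (v - s)))).
    by apply: eq_Rintegral => v _; rewrite gkE.
  by rewrite gkw !mul0r !addr0 mulN1r.
have {}gki : integrable (fun v => 2 * (phi v / (v - s) * kap v)).
  apply: integrable_scaler; move: gki; congr (integrable _).
  by apply/funext => v; exact: gkE.
have ni := integrable_normr phi_int.
(* The majorant of [2 |g kap|]: [L] on the segment, written 1 + (L - 1) because the first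
   coefficient is fixed to 1, plus [sg E2 g q] everywhere, whose integral is [- sg w], plus a
   multiple of [|phi|]. *)
have [bi bE] := Rintegral_lin4 (L - 1) (sg * E2) (12 * e / d ^+ 2)
  (integrable_indic_segment (s - d) (s + d)) (integrable_indic_segment (s - d) (s + d))
  (integrable_quotient_sqdist x y0) ni.
have := ler_norm_Rintegral gki bi.
rewrite bE Rintegral_scale; last first.
  move: (integrable_scaler 2^-1 gki); congr (integrable _).
  by apply/funext => v; rewrite mulKf.
rewrite gkw -(mulrA sg) [E2 * _]wE Rintegral_indic_segment; last by lra.
rewrite -/I normrM (ger0_norm (ler0n R 2)) => main.
have sw : sg * - w <= `|w|.
  by apply: le_trans (ler_norm _) _; rewrite normrM sg1 mul1r normrN.
have eI2 : 12 * e / d ^+ 2 * I <= eta / 2.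
  rewrite mulrAC ler_pdivrMr//; nra.
have {}main : 2 * `|w| <= 2 * (L * d) + `|w| + 12 * e / d ^+ 2 * I.
  apply: le_trans (main _) _; last by lra.
  move=> v; rewrite -/(g v) -/(q v).
  have Dv : 0 < (v - x) ^+ 2 + y ^+ 2 by exact: sqdist_gt0.
  have q0 : 0 < q v by rewrite invr_gt0.
  have qD : ((v - x) ^+ 2 + y ^+ 2) * q v = 1 by rewrite mulfV// gt_eqF.
  have E20 : 0 <= E2 by rewrite addr_ge0 ?sqr_ge0.
  rewrite normrM (ger0_norm (ler0n R 2)) normrM.
  (* Near [s] the sign condition gives [|g| = sg g], so the bound on [kap] yields [|g| + sg E2 g q],
     and [|g| <= L]. *)
  have [vs|vs] := boolP (v \in `[s - d, s + d]%classic).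
    have vsd : `|v - s| < d0.
      move: vs; rewrite inE/= in_itv/= => /andP[? ?]; rewrite ltr_norml.
      by move: dd0 => ?; apply/andP; split; lra.
    have sg_ge0 : 0 <= sg * g v.
      have := phi_sign vsd; rewrite (gM v) mulrA -mulrA -expr2 => sgv.
      have [vs0|vs0] := eqVneq v s.
        by rewrite /g vs0 subrr invr0 mulr0 mulr0.
      by move: sgv; rewrite pmulr_lge0// exprn_even_gt0//= subr_eq0.
    have gE : `|g v| = sg * g v by rewrite -(ger0_norm sg_ge0) (normrM sg) sg1 mul1r.
    have kb : 2 * `|kap v| <= 1 + E2 * q v.
      rewrite -[X in X + _]qD -mulrDl normrM (gtr0_norm q0) mulrA ler_pM2r//.
      have : `|(x - s) * (v - x) - y ^+ 2| <= ((v - x) ^+ 2 + y ^+ 2 + E2) / 2.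
        rewrite ler_norml /E2; apply/andP; split.
          by have := sqr_ge0 (v - x + (x - s)); have := sqr_ge0 y; nra.
        by have := sqr_ge0 (v - x - (x - s)); have := sqr_ge0 y; nra.
      by lra.
    rewrite indicE vs/= mulr1.
    have cph : 0 <= 12 * e / d ^+ 2 * `|phi v|.
      by rewrite mulr_ge0// divr_ge0 ?mulr_ge0// ltW.
    have gL : `|g v| <= L by exact: quotient_bounded.
    have := ler_wpM2l (normr_ge0 (g v)) kb; rewrite mulrDr mulr1 {3}gE.
    rewrite (_ : sg * g v * (E2 * q v) = sg * E2 * (g v * q v)); last by ring.
    by lra.
  (* Far from [s] the term [sg E2 g q] may be negative, so its absolute value is also charged to
     [|phi|]: two copies of [|kap| d <= 4 e] and one of [E2 q d <= 4 e] make up the 12. *)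
  have vsd : d < `|v - s|.
    move: vs; rewrite notin_setE/= in_itv/= => /negP; rewrite negb_and -!ltNge.
    by case/orP => ?; rewrite ltr_normr; apply/orP; [right|left]; lra.
  have vx : d / 2 <= `|v - x|.
    by have := ler_distD x v s; move: xs ed vsd; lra.
  have u2 : `|v - x| ^+ 2 = (v - x) ^+ 2 by rewrite real_normK ?num_real.
  have gb : `|g v| * d <= `|phi v|.
    by rewrite [in leRHS](gM v) (normrM (g v)) ler_wpM2l// ltW.
  have e4 : 4 * e = 4 * e * (((v - x) ^+ 2 + y ^+ 2) * q v) by rewrite qD mulr1.
  have kb : `|kap v| * d <= 4 * e.
    rewrite normrM (gtr0_norm q0) e4 mulrA mulrAC ler_pM2r//.
    have : `|(x - s) * (v - x) - y ^+ 2| <= e * (`|v - x| + y).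
      apply: le_trans (ler_normB _ _) _; rewrite normrM (ger0_norm (sqr_ge0 y)).
      by rewrite mulrDr expr2 lerD// ler_pM// ltW.
    move=> /(ler_wpM2r (ltW d_gt0)) /le_trans; apply.
    have : (`|v - x| + y) * d <= 4 * (`|v - x| ^+ 2 + y ^+ 2).
      by have := sqr_ge0 y; move: ye ed vx y0; nra.
    by rewrite u2 => /(ler_wpM2l (ltW e0)); lra.
  have Eb : E2 * q v * d <= 4 * e.
    rewrite e4 mulrA mulrAC ler_pM2r// -u2.
    have /(ler_wpM2r (ltW d_gt0)) : E2 <= 2 * e ^+ 2.
      rewrite /E2; have <- : `|x - s| ^+ 2 = (x - s) ^+ 2 by rewrite real_normK ?num_real.
      by have := normr_ge0 (x - s); move: xs ye y0; nra.
    have /(ler_wpM2l (ltW e0)) : d ^+ 2 / 4 <= `|v - x| ^+ 2 by move: vx d_gt0; nra.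
    have /(ler_wpM2l (ltW e0)) : e * d <= d ^+ 2 / 2 by move: ed d_gt0; nra.
    have := mulr_ge0 (ltW e0) (sqr_ge0 y); lra.
  have Eq0 : 0 <= E2 * q v by rewrite mulr_ge0// ltW.
  have lb : - (`|g v| * (E2 * q v)) <= sg * E2 * (g v * q v).
    rewrite (_ : sg * E2 * (g v * q v) = sg * g v * (E2 * q v)); last by ring.
    rewrite -mulNr ler_wpM2r// -[`|g v|]mul1r -sg1 -(normrM sg (g v)).
    by have := ler_norm (- (sg * g v)); rewrite normrN; lra.
  rewrite indicE (negbTE vs) /= mulr0 addr0 add0r.
  have : 2 * (`|g v| * `|kap v|) + `|g v| * (E2 * q v) <= 12 * e / d ^+ 2 * `|phi v|.
    rewrite [leRHS]mulrAC ler_pdivlMr//.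
    have -> : (2 * (`|g v| * `|kap v|) + `|g v| * (E2 * q v)) * d ^+ 2
       = `|g v| * d * (2 * (`|kap v| * d) + E2 * q v * d) by ring.
    rewrite [leRHS]mulrC; apply: ler_pM => //.
    - by rewrite mulr_ge0// ltW.
    - by rewrite addr_ge0// ?mulr_ge0// ?(ltW d_gt0)//; lra.
    - by lra.
  by lra.
by lra.
Qed.

End BoundaryBehaviour.

(** * Sign of Im Z near real points where [phi] is negative *)

Section NegativeBoundary.
Context {R : realType}.
Notation mu := (@lebesgue_measure R).
Notation integrable f := (mu.-integrable setT (EFin \o f)).

Lemma cim_lt0_near (phi : R -> R) s : integrable phi -> {for s, continuous phi} -> phi s < 0 ->
  exists2 e, 0 < e & forall x y, `|x - s| < e -> 0 < y -> y < e -> cim phi x y < 0.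
Proof.
move=> phi_int cphi phis.
have ni : integrable (fun v => - phi v).
  by move: (integrable_scaler (-1) phi_int); congr (integrable _); apply/funext => v; rewrite mulN1r.
have [||e e0 H] := @cim_gt0_near _ _ ni s; first exact: continuousN.
  by rewrite oppr_gt0.
exists e => // x y xs y0 ye; have := H x y xs y0 ye.
rewrite -oppr_lt0 /cim; congr (_ < 0).
rewrite -mulN1r -Rintegral_scale; last exact: integrable_kim.
  by apply: eq_Rintegral => v _; rewrite mulN1r mulNr opprK.
Qed.

End NegativeBoundary.

(** * Consequences of the sign pattern of [phi] for real values of Z *)

Section TwoPeakProfile.
Context {R : realType}.
Notation mu := (@lebesgue_measure R).
Notation integrable f := (mu.-integrable setT (EFin \o f)).
Implicit Types x y v s : R.

(* For [phi = f0^`()] the last clause says [f0 a = f0 b]. *)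
Record two_peak_profile (phi : R -> R) (a c b L : R) : Prop := TwoPeakProfile {
  prof_int : integrable phi ;
  prof_ac : a < c ;
  prof_cb : c < b ;
  prof_lip : forall u v, `|phi u - phi v| <= L * `|u - v| ;
  prof_a : phi a = 0 ;
  prof_c : phi c = 0 ;
  prof_b : phi b = 0 ;
  prof_gt0 : forall v, v < a \/ c < v < b -> 0 < phi v ;
  prof_lt0 : forall v, a < v < c \/ b < v -> phi v < 0 ;
  prof_mean : \int[mu]_v (phi v * \1_`[a, b] v) = 0
}.

Variables (phi : R -> R) (a c b L : R).
Hypothesis prof : two_peak_profile phi a c b L.

Let phi_int : integrable phi. Proof. exact: prof_int prof. Qed.
Let ac : a < c. Proof. exact: prof_ac prof. Qed.
Let cb : c < b. Proof. exact: prof_cb prof. Qed.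

Lemma prof_lip0 s : phi s = 0 -> forall v, `|phi v| <= L * `|v - s|.
Proof. by move=> s0 v; have := prof_lip prof v s; rewrite s0 subr0. Qed.

Variant profile_spec v : Prop :=
| ProfileZero of v = a \/ v = c \/ v = b & phi v = 0
| ProfileLeft of v < a & 0 < phi v
| ProfileDown of a < v & v < c & phi v < 0
| ProfileUp of c < v & v < b & 0 < phi v
| ProfileRight of b < v & phi v < 0.

Lemma profileP v : profile_spec v.
Proof.
have [va|va|->] := ltgtP v a.
- by apply: ProfileLeft => //; apply: (prof_gt0 prof); left.
- have [vc|vc|->] := ltgtP v c.
  + by apply: ProfileDown => //; apply: (prof_lt0 prof); left; rewrite va.
  + have [vb|vb|->] := ltgtP v b.
    * by apply: ProfileUp => //; apply: (prof_gt0 prof); right; rewrite vc.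
    * by apply: ProfileRight => //; apply: (prof_lt0 prof); right.
    * by apply: ProfileZero; [right; right|exact: prof_b prof].
  + by apply: ProfileZero; [right; left|exact: prof_c prof].
- by apply: ProfileZero; [left|exact: prof_a prof].
Qed.

Lemma profile_cubic_le0 v : phi v * ((v - a) * (v - c) * (v - b)) <= 0.
Proof.
have sgn (p q r : R) : 0 <= p -> 0 <= q -> 0 <= r -> 0 <= p * q * r.
  by move=> *; rewrite !mulr_ge0.
move: ac cb => ac' cb'.
case: (profileP v) => [_ ->|va pv|av vc pv|cv vb pv|bv pv].
- by rewrite mul0r.
- rewrite pmulr_rle0//; have : 0 <= (a - v) * (c - v) * (b - v) by apply: sgn; lra.
  by lra.
- rewrite nmulr_rle0//; have : 0 <= (v - a) * (c - v) * (b - v) by apply: sgn; lra.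
  by lra.
- rewrite pmulr_rle0//; have : 0 <= (v - a) * (v - c) * (b - v) by apply: sgn; lra.
  by lra.
- rewrite nmulr_rle0//; have : 0 <= (v - a) * (v - c) * (v - b) by apply: sgn; lra.
  by lra.
Qed.

(** The coefficients come from dividing [(v - a) (v - b)] by [v - c]: quotient [v + c - a - b],
    remainder [(c - a) (c - b)]. The resulting integrand is the cubic sign condition divided by a
    positive square, hence nonpositive. *)
Lemma profile_root_quotient x y : 0 < y -> cim phi x y = 0 ->
  cre phi x y <= (c - a) * (b - c) *
    \int[mu]_v (phi v / (v - c) * ((v - x) ^+ 2 + y ^+ 2)^-1).
Proof.
move=> y0 cim0; have lipc := prof_lip0 (prof_c prof).
have [fi] := Rintegral_lin4 ((x + c - a - b) / y) ((c - a) * (c - b)) 0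
  (integrable_kre phi_int x y0) (integrable_kim phi_int x y0)
  (integrable_quotient_sqdist phi_int lipc x y0) (integrable_kre phi_int x y0).
rewrite -/(cre phi x y) -/(cim phi x y) cim0 mulr0 addr0 mul0r addr0 => fE.
suff : cre phi x y + (c - a) * (c - b) *
    \int[mu]_v (phi v / (v - c) * ((v - x) ^+ 2 + y ^+ 2)^-1) <= 0.
  by rewrite -(opprB b c) mulrN mulNr subr_le0.
rewrite -fE; apply: Rintegral_le0 => // v.
rewrite mul0r addr0; have D0 := sqdist_gt0 x v y0.
have [->|vc] := eqVneq v c; first by rewrite (prof_c prof) !mul0r !mulr0 !addr0.
have vc0 : v - c != 0 by rewrite subr_eq0.
rewrite [leLHS](_ : _ = phi v * ((v - a) * (v - c) * (v - b)) /
  ((v - c) ^+ 2 * ((v - x) ^+ 2 + y ^+ 2))).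
  rewrite pmulr_lle0 ?profile_cubic_le0// invr_gt0 mulr_gt0//.
  by rewrite exprn_even_gt0.
by rewrite /kre /kim; field; rewrite vc0 !gt_eqF.
Qed.

(** Eliminates the integral Q between the previous estimate and [cauchy_quotient] at [s = c]. It
    gives both the upper bound on values at roots and the boundedness of the root set. *)
Lemma profile_root_bound x y : 0 < y -> cim phi x y = 0 ->
  let P := \int[mu]_v (phi v / (v - c)) in
  cre phi x y * ((x - c) ^+ 2 + y ^+ 2) <= (c - a) * (b - c) * (P - cre phi x y).
Proof.
move=> y0 cim0 /=; set P := Rintegral _ _ _; have lipc := prof_lip0 (prof_c prof).
have := cauchy_quotient phi_int lipc x y0; rewrite cim0 mulr0 addr0 -/P => <-.
rewrite mulrCA [leLHS]mulrC ler_pM2l ?profile_root_quotient//.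
by rewrite ltr_wpDl ?sqr_ge0 ?exprn_gt0.
Qed.

Lemma profile_root_lt x y : 0 < y -> cim phi x y = 0 -> 0 < cre phi x y ->
  cre phi x y < \int[mu]_v (phi v / (v - c)).
Proof.
move=> y0 cim0 cre0; rewrite -subr_gt0.
have E0 : 0 < (x - c) ^+ 2 + y ^+ 2 by rewrite ltr_wpDl ?sqr_ge0 ?exprn_gt0.
have := lt_le_trans (mulr_gt0 cre0 E0) (profile_root_bound y0 cim0).
by rewrite pmulr_rgt0// mulr_gt0// subr_gt0.
Qed.

(* If [Z z = t] and [Z' z = 0], partial fractions turn the integral of
   [phi v (v - a) (v - c) (v - b) / |v - z|^4] into [t]. *)
Lemma profile_root_simple x y : 0 < y -> cim phi x y = 0 -> 0 < cre phi x y ->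
  0 < dcre phi x y ^+ 2 + dcim phi x y ^+ 2.
Proof.
move=> y0 cim0 cre0; rewrite lt_neqAle addr_ge0 ?sqr_ge0// andbT eq_sym.
rewrite paddr_eq0 ?sqr_ge0// !sqrf_eq0; apply/negP => /andP[/eqP d1 /eqP d2].
(* In u = v - x the cubic is u^3 + A u^2 + B u + C; matching coefficients over |v - z|^4 gives the
   combination of [kre], [kim], [dkre], [dkim] below, of which only the [kre] term survives. *)
pose A := (x - a) + (x - c) + (x - b).
pose B := (x - a) * (x - c) + (x - a) * (x - b) + (x - c) * (x - b).
pose C := (x - a) * (x - c) * (x - b).
have [fi] := Rintegral_lin4 (A / (2 * y) + C / (2 * y ^+ 3)) (A / 2 - C / (2 * y ^+ 2))
  (- y / 2 + B / (2 * y))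
  (integrable_kre phi_int x y0) (integrable_kim phi_int x y0)
  (integrable_dkre phi_int x y0) (integrable_dkim phi_int x y0).
rewrite -/(cre phi x y) -/(cim phi x y) -/(dcre phi x y) -/(dcim phi x y).
rewrite cim0 d1 d2 !mulr0 !addr0 => fE.
suff : cre phi x y <= 0 by rewrite leNgt cre0.
rewrite -fE; apply: Rintegral_le0 => // v.
have D0 := sqdist_gt0 x v y0.
rewrite [leLHS](_ : _ = phi v * ((v - a) * (v - c) * (v - b)) /
  ((v - x) ^+ 2 + y ^+ 2) ^+ 2).
  by rewrite pmulr_lle0 ?profile_cubic_le0// invr_gt0 exprn_gt0.
by rewrite /kre /kim /dkre /dkim /A /B /C; field; rewrite !gt_eqF.
Qed.

Lemma integrable_profile_segment : integrable (fun v => phi v * \1_`[a, b] v).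
Proof.
apply: (integrable_mulr phi_int (C := 1)); last first.
  by move=> v; rewrite indicE normr_nat lern1 leq_b1.
by apply: measurable_indic.
Qed.

(** On [[a, b]], replacing [1 / (v - a)] by its value at [c] can only increase the integrand,
    because [phi] changes sign from negative to positive there; outside, the integrand is
    nonpositive. The majorant integrates to 0 by [prof_mean]. *)
Lemma profile_quotient_left_le0 : \int[mu]_v (phi v / (v - a)) <= 0.
Proof.
have := ler_Rintegral (integrable_quotient phi_int (prof_lip0 (prof_a prof)))
  (integrable_scaler (c - a)^-1 integrable_profile_segment).
rewrite Rintegral_scale; last exact: integrable_profile_segment.
rewrite (prof_mean prof) mulr0; move: ac cb => ac' cb'; apply => v; rewrite indicE mem_setE in_itv/=.
have ca0 : 0 < c - a by rewrite subr_gt0.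
case: (profileP v) => [_ ->|va pv|av vc pv|cv vb pv|bv pv].
- by rewrite !(mul0r, mulr0).
- rewrite (leNgt a) va/= !mulr0 pmulr_rle0// invr_le0 subr_le0 ltW//.
- rewrite (ltW av) (ltW (lt_trans vc cb))/= mulr1 mulrC ler_nM2r//.
  by rewrite lef_pV2 ?posrE ?subr_gt0//; lra.
- rewrite (ltW vb) (ltW (lt_trans ac cv))/= mulr1 mulrC ler_pM2r//.
  have va : 0 < v - a by rewrite subr_gt0 (lt_trans ac).
  by rewrite lef_pV2 ?posrE//; lra.
- rewrite [v <= b]leNgt bv andbF /= !mulr0 nmulr_rle0// invr_ge0.
  by have := lt_trans ac cb; lra.
Qed.

(** Mirror image of the previous argument, with [1 / (v - b)] replaced by its value at [c]. *)
Lemma profile_quotient_right_le0 : \int[mu]_v (phi v / (v - b)) <= 0.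
Proof.
have := ler_Rintegral (integrable_quotient phi_int (prof_lip0 (prof_b prof)))
  (integrable_scaler (- (b - c)^-1) integrable_profile_segment).
rewrite Rintegral_scale; last exact: integrable_profile_segment.
rewrite (prof_mean prof) mulr0; move: ac cb => ac' cb'; apply => v; rewrite indicE mem_setE in_itv/=.
have bc0 : 0 < b - c by rewrite subr_gt0.
rewrite -(opprB b v) invrN mulrN.
case: (profileP v) => [_ ->|va pv|av vc pv|cv vb pv|bv pv].
- by rewrite !(mul0r, mulr0) oppr0.
- rewrite (leNgt a) va/= !mulr0 oppr_le0 mulr_ge0 ?(ltW pv)// invr_ge0.
  by have := lt_trans ac cb; lra.
- rewrite (ltW av) (ltW (lt_trans vc cb))/= mulr1 mulNr lerN2 mulrC ler_nM2l//.
  have vb : 0 < b - v by rewrite subr_gt0 (lt_trans vc).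
  by rewrite lef_pV2 ?posrE//; lra.
- rewrite (ltW vb) (ltW (lt_trans ac cv))/= mulr1 mulNr lerN2 mulrC ler_pM2l//.
  by rewrite lef_pV2 ?posrE ?subr_gt0//; lra.
- rewrite [v <= b]leNgt bv andbF /= !mulr0 oppr_le0 nmulr_rge0// invr_le0.
  by rewrite subr_le0 ltW.
Qed.

End TwoPeakProfile.

(** * Existence of a point where Z takes a given value below Z(c) *)

Section RootExistence.
Context {R : realType}.
Notation mu := (@lebesgue_measure R).
Variables (phi : R -> R) (a c b L : R).
Hypothesis prof : two_peak_profile phi a c b L.
Implicit Types x y v s t : R.

Let phi_int := prof_int prof.

Lemma exists_lt4 (e1 e2 e3 e4 : R) : 0 < e1 -> 0 < e2 -> 0 < e3 -> 0 < e4 ->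
  exists2 e, 0 < e & [/\ e < e1, e < e2, e < e3 & e < e4].
Proof.
move=> e10 e20 e30 e40; pose m := Num.min (Num.min e1 e2) (Num.min e3 e4).
have m0 : 0 < m by rewrite !lt_min e10 e20 e30.
exists (m / 2); first by rewrite divr_gt0.
have : m / 2 < m by rewrite ltr_pdivrMr// ltr_pMr// ltr1n.
by rewrite {2}/m !lt_min => /andP[/andP[-> ->] /andP[-> ->]].
Qed.

Lemma profile_continuous s : {for s, continuous phi}.
Proof.
apply/cvgrPdist_le => e e0.
have L1 : 0 < `|L| + 1 by rewrite ltr_wpDl.
apply/nbhs_ballP; exists (e / (`|L| + 1)); first by rewrite /= divr_gt0.
move=> v; rewrite /ball/= ltr_pdivlMr// => vs.
apply: le_trans (prof_lip prof s v) _.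
by have := ler_norm L; have := normr_ge0 (s - v); nra.
Qed.

Lemma continuous_pair (f g : R -> R) (s : R) : {for s, continuous f} ->
  {for s, continuous g} -> {for s, continuous (fun s => (f s, g s))}.
Proof. by move=> cf cg; exact: (cvg_pair cf cg). Qed.

Lemma continuous_cim_line y : 0 < y -> continuous (fun x => cim phi x y).
Proof.
move=> y0 x.
apply: (@continuous_comp _ _ _ (fun x => (x, y)) (fun z : R * R => cim phi z.1 z.2)).
  by apply: continuous_pair; [exact: cvg_id|exact: cvg_cst].
exact: (continuous_cauchy phi_int x y0).2.
Qed.

(** Near [c], [phi] has the sign of [v - c], hence [sg = 1]; for [a] and [b] below the sign is
    opposite, hence [sg = -1]. The radius stops at the nearest other zero. *)
Lemma cre_cvg_c (eta : R) : 0 < eta ->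
  exists2 e, 0 < e & forall x y, `|x - c| < e -> 0 < y -> y < e -> cim phi x y = 0 ->
    `|cre phi x y - \int[mu]_v (phi v / (v - c))| <= eta.
Proof.
have ac := prof_ac prof; have cb := prof_cb prof.
apply: (cre_cvg_root phi_int (prof_lip0 prof (prof_c prof)) (sg := 1) (d0 := Num.min (c - a) (b - c))).
- by rewrite normr1.
- by rewrite lt_min !subr_gt0 ac.
move=> v; rewrite lt_min !ltr_norml => /andP[/andP[? ?] /andP[? ?]]; rewrite mul1r.
case: (profileP prof v) => [_ ->|va pv|av vc pv|cv vb pv|bv pv]; rewrite ?mul0r//; try lra.
- by rewrite nmulr_rge0//; lra.
- by rewrite pmulr_rge0//; lra.
Qed.

Lemma cre_cvg_a (eta : R) : 0 < eta ->
  exists2 e, 0 < e & forall x y, `|x - a| < e -> 0 < y -> y < e -> cim phi x y = 0 ->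
    `|cre phi x y - \int[mu]_v (phi v / (v - a))| <= eta.
Proof.
have ac := prof_ac prof; have cb := prof_cb prof.
apply: (cre_cvg_root phi_int (prof_lip0 prof (prof_a prof)) (sg := -1) (d0 := c - a)).
- by rewrite normrN1.
- by rewrite subr_gt0.
move=> v; rewrite ltr_norml => /andP[? ?]; rewrite mulN1r mulNr oppr_ge0.
case: (profileP prof v) => [_ ->|va pv|av vc pv|cv vb pv|bv pv]; rewrite ?mul0r//; try lra.
- by rewrite pmulr_rle0//; lra.
- by rewrite nmulr_rle0//; lra.
Qed.

Lemma cre_cvg_b (eta : R) : 0 < eta ->
  exists2 e, 0 < e & forall x y, `|x - b| < e -> 0 < y -> y < e -> cim phi x y = 0 ->
    `|cre phi x y - \int[mu]_v (phi v / (v - b))| <= eta.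
Proof.
have ac := prof_ac prof; have cb := prof_cb prof.
apply: (cre_cvg_root phi_int (prof_lip0 prof (prof_b prof)) (sg := -1) (d0 := b - c)).
- by rewrite normrN1.
- by rewrite subr_gt0.
move=> v; rewrite ltr_norml => /andP[? ?]; rewrite mulN1r mulNr oppr_ge0.
case: (profileP prof v) => [_ ->|va pv|av vc pv|cv vb pv|bv pv]; rewrite ?mul0r//; try lra.
- by rewrite pmulr_rle0//; lra.
- by rewrite nmulr_rle0//; lra.
Qed.

(** Keeps the set to be minimised over away from the real axis. The tolerances [t / 2] at [a], [b]
    and [(P - t1) / 2] at [c] are half the gaps between the boundary values and [[t, t1]]. *)
Lemma profile_boundary t t1 s : 0 < t -> t1 < \int[mu]_v (phi v / (v - c)) ->
  exists2 e, 0 < e & forall x y, `|x - s| < e -> 0 < y -> y < e -> cim phi x y = 0 ->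
    t <= cre phi x y <= t1 -> False.
Proof.
move=> t0 t1P; set P := Rintegral _ _ _ in t1P.
have pos : 0 < phi s -> exists2 e, 0 < e & forall x y, `|x - s| < e -> 0 < y -> y < e ->
    cim phi x y = 0 -> t <= cre phi x y <= t1 -> False.
  move=> /(cim_gt0_near phi_int (profile_continuous (s := s)))[e e0 He].
  by exists e => // x y xs y0 ye cim0; have := He x y xs y0 ye; rewrite cim0 ltxx.
have neg : phi s < 0 -> exists2 e, 0 < e & forall x y, `|x - s| < e -> 0 < y -> y < e ->
    cim phi x y = 0 -> t <= cre phi x y <= t1 -> False.
  move=> /(cim_lt0_near phi_int (profile_continuous (s := s)))[e e0 He].
  by exists e => // x y xs y0 ye cim0; have := He x y xs y0 ye; rewrite cim0 ltxx.
case: (profileP prof s) => [|_ /pos//|_ _ /neg//|_ _ /pos//|_ /neg//].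
have t20 : 0 < t / 2 by rewrite divr_gt0.
move=> [->|[->|->]] _.
- have [e e0 He] := cre_cvg_a t20; exists e => // x y xs y0 ye cim0 /andP[tl _].
  have := He x y xs y0 ye cim0; rewrite ler_norml => /andP[_].
  by have := profile_quotient_left_le0 prof; lra.
- have P0 : 0 < (P - t1) / 2 by rewrite divr_gt0// subr_gt0.
  have [e e0 He] := cre_cvg_c P0; exists e => // x y xs y0 ye cim0 /andP[_ tr].
  by have := He x y xs y0 ye cim0; rewrite -/P ler_norml => /andP[+ _]; lra.
- have [e e0 He] := cre_cvg_b t20; exists e => // x y xs y0 ye cim0 /andP[tl _].
  have := He x y xs y0 ye cim0; rewrite ler_norml => /andP[_].
  by have := profile_quotient_right_le0 prof; lra.
Qed.

Lemma profile_root_above t : t < \int[mu]_v (phi v / (v - c)) ->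
  exists x y, [/\ 0 < y, cim phi x y = 0 & t < cre phi x y].
Proof.
set P := Rintegral _ _ _ => tP.
have ac := prof_ac prof; have cb := prof_cb prof.
have P0 : 0 < (P - t) / 2 by rewrite divr_gt0// subr_gt0.
have [e1 e10 He1] := cre_cvg_c P0.
have ca0 : 0 < c - a by rewrite subr_gt0.
have bc0 : 0 < b - c by rewrite subr_gt0.
have [d d0 [de1 dca dbc _]] := exists_lt4 e10 ca0 bc0 ltr01.
have pl : phi (c - d) < 0 by apply: (prof_lt0 prof); left; apply/andP; split; lra.
have pr : 0 < phi (c + d) by apply: (prof_gt0 prof); right; apply/andP; split; lra.
have [e2 e20 He2] := cim_lt0_near phi_int (profile_continuous (s := _)) pl.
have [e3 e30 He3] := cim_gt0_near phi_int (profile_continuous (s := _)) pr.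
(* The height comes after [d], since [e2] and [e3] depend on the endpoints [c - d] and [c + d] of
   the horizontal segment. *)
have [y y0 [ye1 ye2 ye3 _]] := exists_lt4 e10 e20 e30 ltr01.
have cl : cim phi (c - d) y < 0 by apply: He2; rewrite // subrr normr0.
have cr : 0 < cim phi (c + d) y by apply: He3; rewrite // subrr normr0.
have cdd : c - d <= c + d by lra.
have [||x] := IVT cdd (f := fun x => cim phi x y) (v := 0).
- by apply: continuous_subspaceT => x; exact: continuous_cim_line.
- by rewrite ge_min le_max (ltW cl) (ltW cr) orbT.
rewrite in_itv/= => /andP[x1 x2] cim0.
exists x, y; split => //.
have : `|cre phi x y - P| <= (P - t) / 2.
  by apply: He1 => //; rewrite ltr_norml; apply/andP; split; lra.
by rewrite ler_norml => /andP[+ _]; lra.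
Qed.

Lemma closure_le (T : topologicalType) (f : T -> R) (A : set T) z k :
  {for z, continuous f} -> (forall w, A w -> f w <= k) -> closure A z -> f z <= k.
Proof.
move=> cf Ak Az; rewrite leNgt; apply/negP => kf.
have [w [Aw]] := Az _ (cvgr_gt _ cf _ kf).
by rewrite /= ltNge Ak.
Qed.

Let roots t t1 : set (R * R) :=
  [set z | 0 < z.2 /\ cim phi z.1 z.2 = 0 /\ t <= cre phi z.1 z.2 <= t1].

(** Only the strict condition on the height could fail in the limit: heights below 0 are not
    approached, height 0 is excluded by [profile_boundary], and for positive heights continuity
    suffices. *)
Lemma closed_roots t t1 : 0 < t -> t1 < \int[mu]_v (phi v / (v - c)) ->
  closed (roots t t1).
Proof.
move=> t0 t1P [s y] cz.
have [y0|y0|y0] := ltgtP y 0.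
- have [] := cz (ball (s, y) (- y)); first by apply: nbhsx_ballx; rewrite oppr_gt0.
  move=> -[w1 w2] [[/= w20 _]] [/= _]; rewrite /ball/= ltr_norml => /andP[+ _].
  by move: y0; lra.
- have cc := continuous_cauchy phi_int s y0.
  have i1 : cim phi s y <= 0.
    by apply: (closure_le cc.2 _ cz) => w [_ [-> _]].
  have i2 : - cim phi s y <= 0.
    apply: (closure_le (f := fun z : R * R => - cim phi z.1 z.2) _ _ cz).
      exact: (continuousN cc.2).
    by move=> w [_ [-> _]]; rewrite oppr0.
  have i3 : cre phi s y <= t1.
    by apply: (closure_le cc.1 _ cz) => w [_ [_ /andP[]]].
  have i4 : - cre phi s y <= - t.
    apply: (closure_le (f := fun z : R * R => - cre phi z.1 z.2) _ _ cz).
      exact: (continuousN cc.1).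
    by move=> w [_ [_ /andP[]]]; rewrite lerN2.
  split => //=; split; last by rewrite i3 andbT -lerN2.
  by apply/eqP; rewrite eq_le i1 -oppr_le0.
- have [e e0 He] := profile_boundary s t0 t1P.
  have [] := cz (ball (s, y) e); first exact: nbhsx_ballx.
  move=> -[w1 w2] [[/= w20 [cim0 cre0]]] [/= b1 b2]; exfalso.
  apply: (He w1 w2) => //; first by rewrite distrC.
  move: b2; rewrite /ball/= y0 sub0r normrN gtr0_norm//.
Qed.

Lemma compact_roots t t1 : 0 < t -> t1 < \int[mu]_v (phi v / (v - c)) ->
  compact (roots t t1).
Proof.
move=> t0 t1P; set P := Rintegral _ _ _ in t1P.
pose K := (c - a) * (b - c) * (P - t) / t.
(* [K] bounds |z - c|^2, and K <= (K + 1)^2 makes [r] a bound on each coordinate without a square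
   root. *)
pose r := K + 1.
have boxK := compact_setX (@segment_compact R (c - r) (c + r)) (@segment_compact R 0 r).
apply: (subclosed_compact _ boxK); first exact: closed_roots.
move=> -[x y] [/= y0 [cim0 /andP[tl tr]]].
have ac := prof_ac prof; have cb := prof_cb prof.
have k0 : 0 < (c - a) * (b - c) by rewrite mulr_gt0// subr_gt0.
have bnd := profile_root_bound prof y0 cim0; rewrite /= -/P in bnd.
have E0 : 0 <= (x - c) ^+ 2 + y ^+ 2 by rewrite addr_ge0 ?sqr_ge0.
have EK : (x - c) ^+ 2 + y ^+ 2 <= K.
  rewrite ler_pdivlMr//; nra.
have K0 : 0 <= K by exact: le_trans EK.
have xr : (x - c) ^+ 2 <= r ^+ 2 by rewrite /r; have := sqr_ge0 y; nra.
have yr : y ^+ 2 <= r ^+ 2 by rewrite /r; have := sqr_ge0 (x - c); nra.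
have r0 : 0 <= r by rewrite /r; lra.
split; rewrite /= in_itv/=.
- move: xr; rewrite -(real_normK (num_real (x - c))) ler_sqr ?nnegrE//.
  by rewrite ler_norml => /andP[? ?]; apply/andP; split; lra.
- by move: yr; rewrite ler_sqr ?nnegrE ?(ltW y0)// => ->.
Qed.

(* Since [Z' z <> 0], moving [z] by [(- e + i sg) / Z' z] with a suitable real
   [sg] in [[- e, e]] keeps [Z] real and decreases it by about [e]. *)
Lemma profile_root_descend x y t : 0 < y -> cim phi x y = 0 -> 0 < t ->
  t < cre phi x y ->
  exists x' y', [/\ 0 < y', cim phi x' y' = 0 & t <= cre phi x' y' < cre phi x y].
Proof.
move=> y0 cim0 t0 tm.
have N0 := profile_root_simple prof y0 cim0 (lt_trans t0 tm).
set d1 := dcre phi x y in N0; set d2 := dcim phi x y in N0.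
set N := _ + _ in N0.
pose K := 2 / y ^+ 3 * \int[mu]_v `|phi v|.
have K0 : 0 <= K.
  apply: mulr_ge0; first by rewrite divr_ge0 ?exprn_ge0 ?(ltW y0).
  by apply: Rintegral_ge0 => v _; exact: normr_ge0.
(* In order: the new value stays above [t]; the remainder, at most 2 K e^2 / N, is at most e / 2;
   the last two give 2 e^2 / N <= y^2 / 4, the range of the expansion. *)
have [||||e e0 [e1 e2 e3 e4]] := @exists_lt4 ((cre phi x y - t) / 2)
    (N / (4 * (K + 1))) N (y ^+ 2 / 8) => //.
- by rewrite divr_gt0// subr_gt0.
- by rewrite divr_gt0// mulr_gt0//; lra.
- by rewrite divr_gt0// exprn_gt0.
have {}e2 : e * (4 * (K + 1)) < N by rewrite -ltr_pdivlMr// mulr_gt0//; lra.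
have Y0 : 0 < y ^+ 2 by rewrite exprn_gt0.
pose h1 s := (- e * d1 + s * d2) / N.
pose h2 s := (e * d2 + s * d1) / N.
have hN s : h1 s ^+ 2 + h2 s ^+ 2 = (e ^+ 2 + s ^+ 2) / N.
  by rewrite /h1 /h2 /N; field; rewrite gt_eqF.
have hre s : h1 s * d1 - h2 s * d2 = - e.
  by rewrite /h1 /h2 /N; field; rewrite gt_eqF.
have him s : h1 s * d2 + h2 s * d1 = s.
  by rewrite /h1 /h2 /N; field; rewrite gt_eqF.
have hle s : `|s| <= e -> h1 s ^+ 2 + h2 s ^+ 2 <= y ^+ 2 / 4.
  move=> se; rewrite hN ler_pdivrMr// -(real_normK (num_real s)).
  by have := normr_ge0 s; nra.
have hKle s : `|s| <= e -> K * (h1 s ^+ 2 + h2 s ^+ 2) <= e / 2.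
  move=> se; rewrite hN mulrA ler_pdivrMr//.
  have : s ^+ 2 <= e ^+ 2 by rewrite -(real_normK (num_real s)) ler_sqr ?nnegrE// ltW.
  move=> /(ler_wpM2l K0); have := sqr_ge0 e; nra.
have hy s : `|s| <= e -> 0 < y + h2 s.
  move=> /hle hs; rewrite ltNge; apply/negP => yh; have := sqr_ge0 (h1 s); nra.
have Zre s : `|s| <= e -> `|cre phi (x + h1 s) (y + h2 s) - cre phi x y + e| <= e / 2.
  move=> se; have [+ _] := cauchy_expansion phi_int x y0 (hle _ se).
  by rewrite hre opprK => /le_trans; apply; exact: hKle.
have Zim s : `|s| <= e -> `|cim phi (x + h1 s) (y + h2 s) - s| <= e / 2.
  move=> se; have [_ +] := cauchy_expansion phi_int x y0 (hle _ se).
  by rewrite him cim0 subr0 => /le_trans; apply; exact: hKle.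
have ee : - e <= e by lra.
(* Along this path Im Z equals [s] up to an error [e / 2], so it changes sign between [- e] and
   [e]. *)
have [||s] := IVT ee (f := fun s => cim phi (x + h1 s) (y + h2 s)) (v := 0).
- apply: continuous_in_subspaceT => s; rewrite inE/= in_itv/= -ler_norml => se.
  apply: (@continuous_comp _ _ _ (fun s => (x + h1 s, y + h2 s))
    (fun z : R * R => cim phi z.1 z.2)); last first.
    exact: (continuous_cauchy phi_int (x + h1 s) (hy _ se)).2.
  apply: continuous_pair; apply: cvgD; try exact: cvg_cst;
  apply: cvgMl; apply: cvgD; try exact: cvg_cst; apply: cvgMl; exact: cvg_id.
- have : `|cim phi (x + h1 (- e)) (y + h2 (- e)) - - e| <= e / 2.
    by apply: Zim; rewrite normrN gtr0_norm.
  have : `|cim phi (x + h1 e) (y + h2 e) - e| <= e / 2 by apply: Zim; rewrite gtr0_norm.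
  rewrite !ler_norml ge_min le_max => /andP[? _] /andP[_ ?].
  by apply/andP; split; apply/orP; [left|right]; lra.
rewrite in_itv/= -ler_norml => se cims.
exists (x + h1 s), (y + h2 s); split => //; first exact: hy.
have := Zre _ se; rewrite ler_norml => /andP[? ?].
by apply/andP; split; lra.
Qed.

Lemma profile_root_exists t : 0 < t -> t < \int[mu]_v (phi v / (v - c)) ->
  exists x y, [/\ 0 < y, cim phi x y = 0 & cre phi x y = t].
Proof.
move=> t0 tP; have [x1 [y1 [y10 cim1 t1]]] := profile_root_above tP.
(* The value at this first root is strictly below Z(c), so it is an admissible upper level for a
   compact, nonempty root set. *)
have t1P := profile_root_lt prof y10 cim1 (lt_trans t0 t1).
have [|||[x y]] := @compact_EVT_min _ R (fun z : R * R => cre phi z.1 z.2)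
    (roots t (cre phi x1 y1)).
- by exists (x1, y1); split => //=; split => //; rewrite lexx ltW.
- exact: compact_roots.
- apply: continuous_in_subspaceT => -[x y]; rewrite inE => -[/= y0 _].
  exact: (continuous_cauchy phi_int x y0).1.
rewrite inE => -[/= y0 [cim0 /andP[tl tr]]] zmin.
exists x, y; split => //; apply/eqP; rewrite eq_le tl andbT leNgt; apply/negP => tm.
have [x' [y' [y'0 cim' /andP[tl' lt']]]] := profile_root_descend y0 cim0 t0 tm.
have : (x', y') \in roots t (cre phi x1 y1).
  by rewrite inE; split => //=; split => //; rewrite tl' (le_trans (ltW lt')).
by move=> /zmin/=; rewrite leNgt lt'.
Qed.

End RootExistence.

(** * From zeros of [Delta] to values of Z *)

Section DispersionRelation.
Context {R : realType}.
Notation mu := (@lebesgue_measure R).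
Notation integrable f := (mu.-integrable setT (EFin \o f)).
Implicit Types (phi : R -> R) (k p q : R).

(** With lambda = p + i q, the denominator is i k (v - z) for z = i lambda / k. For negative [k]
    this z lies in the lower half plane; passing to its conjugate accounts for the absolute values
    of [k]. *)
Lemma Delta_kernelE (f k v p q : R) : k != 0 -> 0 < p ->
  (f%:C / ('i * k%:C * v%:C + Complex p q))%C =
  Complex (k^-1 ^+ 2 * `|k| * (f * kim (- q / k) (p / `|k|) v))
          (- k^-1 * (f * kre (- q / k) (p / `|k|) v)).
Proof.
move=> k0 p0.
have E0 : p ^+ 2 + (k * v + q) ^+ 2 != 0 by rewrite gt_eqF// ltr_wpDr ?sqr_ge0 ?exprn_gt0.
have -> : ('i * k%:C * v%:C + Complex p q)%C = Complex p (k * v + q).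
  by apply/eqP; rewrite eq_complex /=; apply/andP; split; apply/eqP; ring.
have -> : (f%:C / Complex p (k * v + q))%C = Complex (f * p / (p ^+ 2 + (k * v + q) ^+ 2))
    (- (f * (k * v + q) / (p ^+ 2 + (k * v + q) ^+ 2))).
  by apply/eqP; rewrite eq_complex /=; apply/andP; split; apply/eqP; field.
have nk0 : `|k| != 0 by rewrite normr_eq0.
have k2 : `|k| ^+ 2 = k ^+ 2 by rewrite real_normK ?num_real.
have -> : kim (- q / k) (p / `|k|) v = `|k| * p / (p ^+ 2 + (k * v + q) ^+ 2).
  rewrite /kim expr_div_n k2.
  have -> : (v - - q / k) ^+ 2 + p ^+ 2 / k ^+ 2 = (p ^+ 2 + (k * v + q) ^+ 2) / k ^+ 2.
    by field.
  rewrite invf_div -k2; field; by rewrite nk0 E0.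
have -> : kre (- q / k) (p / `|k|) v = k * (k * v + q) / (p ^+ 2 + (k * v + q) ^+ 2).
  rewrite /kre expr_div_n k2.
  have -> : (v - - q / k) ^+ 2 + p ^+ 2 / k ^+ 2 = (p ^+ 2 + (k * v + q) ^+ 2) / k ^+ 2.
    by field.
  rewrite invf_div; field; by rewrite k0 E0.
congr Complex; last by field; rewrite k0 E0.
transitivity (`|k| ^+ 2 * k^-1 ^+ 2 * (f * p / (p ^+ 2 + (k * v + q) ^+ 2))); last by ring.
rewrite k2; field; by rewrite k0 E0.
Qed.

(** The prefactor 1 / (i k) exchanges the roles of the two components: the real part of [Delta] is 1
    - Re Z / k^2, and its imaginary part is a nonzero multiple of Im Z. *)
Lemma Delta_eq0 phi k p q : integrable phi -> k != 0 -> 0 < p ->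
  Delta phi k (Complex p q) = 0 <->
  cim phi (- q / k) (p / `|k|) = 0 /\ cre phi (- q / k) (p / `|k|) = k ^+ 2.
Proof.
move=> phi_int k0 p0; set x := - q / k; set y := p / `|k|.
have nk0 : 0 < `|k| by rewrite normr_gt0.
have y0 : 0 < y by rewrite divr_gt0.
have IE : integralC (fun v => (phi v)%:C / ('i * k%:C * v%:C + Complex p q))%C =
    Complex (k^-1 ^+ 2 * `|k| * cim phi x y) (- k^-1 * cre phi x y).
  rewrite /integralC; congr Complex.
    rewrite -(Rintegral_scale _ (integrable_kim phi_int x y0)).
    by apply: eq_Rintegral => v _; rewrite Delta_kernelE.
  rewrite -(Rintegral_scale _ (integrable_kre phi_int x y0)).
  by apply: eq_Rintegral => v _; rewrite Delta_kernelE.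
have -> : Delta phi k (Complex p q) =
    Complex (1 - k^-1 ^+ 2 * cre phi x y) (- (k^-1 ^+ 3 * `|k|) * cim phi x y).
  rewrite /Delta IE.
  have -> : ('i * k%:C)^-1%C = Complex 0 (- k^-1) :> R[i].
    by apply/eqP; rewrite eq_complex /=; apply/andP; split; apply/eqP; field.
  by apply/eqP; rewrite eq_complex /=; apply/andP; split; apply/eqP; ring.
split.
  move=> /eqP; rewrite eq_complex /= => /andP[/eqP re0 /eqP im0]; split.
    apply/eqP; move/eqP: im0; rewrite mulf_eq0 oppr_eq0 mulf_eq0 expf_eq0 /=.
    by rewrite invr_eq0 (negbTE k0) gt_eqF.
  have := congr1 (fun r => k ^+ 2 * r) re0; rewrite mulr0 mulrBr mulr1.
  by rewrite mulrA exprVn mulfV ?expf_neq0// mul1r => /eqP; rewrite subr_eq0 => /eqP.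
move=> [-> ->]; apply/eqP; rewrite eq_complex /= mulr0 eqxx andbT.
by rewrite exprVn mulVf ?expf_neq0// subrr.
Qed.

End DispersionRelation.

(** * Application to two-peaked distribution functions *)

Section TwoPeaked.
Context {R : realType}.
Notation mu := (@lebesgue_measure R).
Notation integrable f := (mu.-integrable setT (EFin \o f)).

Lemma derivable_continuous_at (f : R -> R) s : derivable f s 1 -> {for s, continuous f}.
Proof. by move=> /derivable1_diffP/differentiable_continuous. Qed.

Lemma derive1_bounded_lipschitz (f : R -> R) (C : R) : (forall v, derivable f v 1) ->
  (forall v, `|f^`() v| <= C) -> forall u v, `|f u - f v| <= C * `|u - v|.
Proof.
move=> df dC.
have lt u v : u < v -> `|f u - f v| <= C * `|u - v|.
  move=> uv; have [||w _ E] := @MVT R f f^`() u v uv.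
  - by move=> w _; rewrite derive1E; exact/derivableP.
  - by apply: continuous_subspaceT => w; exact: derivable_continuous_at.
  by rewrite distrC E normrM [`|u - v|]distrC ler_wpM2r.
move=> u v; have [uv|vu|->] := ltgtP u v; first exact: lt.
- by rewrite distrC [`|u - v|]distrC; exact: lt.
- by rewrite !subrr normr0 mulr0.
Qed.

(** The difference quotient is [f (h + s) * h / h ^+ 2], nonnegative for small [h]. *)
Lemma derive1_ge0_at_root (f : R -> R) (s d : R) : derivable f s 1 -> f s = 0 -> 0 < d ->
  (forall v, `|v - s| < d -> 0 <= f v * (v - s)) -> 0 <= f^`() s.
Proof.
move=> df fs d0 fd; rewrite derive1E; apply: limr_ge => //.
apply/nbhs_ballP; exists d => //= h; rewrite /ball/= sub0r normrN => hd h0.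
have := fd (h + s); rewrite addrK fs subr0 => /(_ hd).
rewrite scaler1 /GRing.scale/= => fh.
have -> : h^-1 * f (h + s) = (h ^+ 2)^-1 * (f (h + s) * h) by field.
by rewrite mulr_ge0// invr_ge0 sqr_ge0.
Qed.

Lemma derive1_le0_at_root (f : R -> R) (s d : R) : derivable f s 1 -> f s = 0 -> 0 < d ->
  (forall v, `|v - s| < d -> f v * (v - s) <= 0) -> f^`() s <= 0.
Proof.
move=> df fs d0 fd; rewrite derive1E -oppr_ge0 -deriveN// -derive1E.
apply: (@derive1_ge0_at_root _ s d) => //; first exact: derivableN.
  by rewrite /= fctE fs oppr0.
by move=> v /fd; rewrite fctE mulNr oppr_ge0.
Qed.

Variables (f0 : R -> R) (a c b M : R).
Hypothesis hf0 : distribution_function f0.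
Hypothesis hpeaks : two_peaked f0 a c b M.
Let phi : R -> R := f0^`().

Let phi_derivable (v : R) : derivable phi v 1.
Proof. exact: (df_derivable2 hf0). Qed.

Let phi_cont (v : R) : {for v, continuous phi}.
Proof. exact: derivable_continuous_at. Qed.

(** The fundamental theorem of calculus turns the equal heights of the two peaks into this
    identity. *)
Lemma two_peaked_mean : \int[mu]_v (phi v * \1_`[a, b] v) = 0.
Proof.
have ab : a < b by exact: lt_trans (tp_lt_ac hpeaks) (tp_lt_cb hpeaks).
have cf0 v : {for v, continuous f0} by apply: derivable_continuous_at; exact: (df_derivable hf0).
have FTC : (\int[mu]_(v in `[a, b]) (phi v)%:E = (f0 b)%:E - (f0 a)%:E)%E.
  apply: continuous_FTC2 => //.
  - by apply: continuous_subspaceT => v; exact: phi_cont.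
  - split; first by move=> v _; exact: (df_derivable hf0).
    + by apply: cvg_at_right_filter; exact: cf0.
    + by apply: cvg_at_left_filter; exact: cf0.
transitivity (\int[mu]_(v in `[a, b]) phi v).
  rewrite [RHS]Rintegral_mkcond; apply: eq_Rintegral => v _.
  by rewrite patchE indicE; case: ifPn => _; rewrite ?mulr1 ?mulr0.
by rewrite /Rintegral FTC (tp_f0a hpeaks) (tp_f0b hpeaks) subee.
Qed.

Lemma two_peaked_profile : exists L, two_peak_profile phi a c b L.
Proof.
have [L dL] := df_dphi_bounded hf0; exists L; split.
- exact: df_phi_L1 hf0.
- exact: tp_lt_ac hpeaks.
- exact: tp_lt_cb hpeaks.
- exact: derive1_bounded_lipschitz (df_derivable2 hf0) dL.
- exact: tp_phia hpeaks.
- exact: tp_phic hpeaks.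
- exact: tp_phib hpeaks.
- exact: tp_phi_gt0 hpeaks.
- exact: tp_phi_lt0 hpeaks.
- exact: two_peaked_mean.
Qed.

(** Sign changes give a nonnegative derivative at [c] and nonpositive ones at [a] and [b];
    non-degeneracy makes the one at [c] strict. *)
Lemma two_peaked_increasing_root s : phi s = 0 /\ 0 < phi^`() s <-> s = c.
Proof.
have [L prof] := two_peaked_profile.
have ac := prof_ac prof; have cb := prof_cb prof.
split; last first.
  move=> ->; have c0 := prof_c prof; split => //.
  rewrite lt_neqAle eq_sym (df_nondegenerate hf0 c0)/=.
  apply: (@derive1_ge0_at_root _ _ (Num.min (c - a) (b - c)) (@phi_derivable c)) => //.
    by rewrite lt_min !subr_gt0 ac.
  move=> v; rewrite lt_min !ltr_norml => /andP[/andP[? ?] /andP[? ?]].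
  case: (profileP prof v) => [_ E|va pv|av vc pv|cv vb pv|bv pv]; rewrite -/phi; try lra.
  - by rewrite E mul0r.
  - by rewrite nmulr_rge0//; lra.
  - by rewrite pmulr_rge0//; lra.
move=> [s0 ds]; case: (profileP prof s) => [|_|_ _|_ _|_]; rewrite ?s0 ?ltxx//.
move=> [sa|[//|sb]] _; exfalso; move: ds; rewrite ltNge => /negP; apply.
- rewrite sa; apply: (@derive1_le0_at_root _ _ (c - a) (@phi_derivable a) (prof_a prof)).
    by rewrite subr_gt0.
  move=> v; rewrite ltr_norml => /andP[? ?].
  case: (profileP prof v) => [_ E|va pv|av vc pv|cv vb pv|bv pv]; rewrite -/phi; try lra.
  - by rewrite E mul0r.
  - by rewrite pmulr_rle0//; lra.
  - by rewrite nmulr_rle0//; lra.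
- rewrite sb; apply: (@derive1_le0_at_root _ _ (b - c) (@phi_derivable b) (prof_b prof)).
    by rewrite subr_gt0.
  move=> v; rewrite ltr_norml => /andP[? ?].
  case: (profileP prof v) => [_ E|va pv|av vc pv|cv vb pv|bv pv]; rewrite -/phi; try lra.
  - by rewrite E mul0r.
  - by rewrite pmulr_rle0//; lra.
  - by rewrite nmulr_rle0//; lra.
Qed.

(** By the previous lemma the counted set is [[set c]] or empty, according to the sign of [penrose]
    at [c]. *)
Lemma two_peaked_Nplus (k : R) : k != 0 ->
  Nplus phi k = 1%N <-> k ^+ 2 < \int[mu]_v (phi v / (v - c)).
Proof.
move=> k0.
have pE : penrose phi k c < 0 <-> k ^+ 2 < \int[mu]_v (phi v / (v - c)).
  have k2 : 0 < k ^+ 2 by rewrite exprn_even_gt0.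
  by rewrite /penrose subr_lt0 ltr_pdivlMl// mulr1.
rewrite -pE /Nplus; split.
  move=> N1; apply: contrapT => pc.
  move: N1; rewrite (_ : [set s | _] = set0) ?fset_set0//.
  rewrite -subset0 => s [s0 ds ps]; apply: pc.
  by have <- : s = c by apply/two_peaked_increasing_root.
move=> pc; rewrite (_ : [set s | _] = [set c]) ?fset_set1; first exact: finmap.cardfs1.
apply/seteqP; split => s /=.
  by move=> [s0 ds _]; apply/two_peaked_increasing_root.
by move=> ->; have [_ /(_ erefl)[c0 dc]] := two_peaked_increasing_root c.
Qed.

Lemma two_peaked_Lambda (k : R) : k != 0 ->
  (Lambda phi k `&` [set lambda : R[i] | 0 < complex.Re lambda] !=set0) <->
  k ^+ 2 < \int[mu]_v (phi v / (v - c)).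
Proof.
move=> k0; have [L prof] := two_peaked_profile.
have k2 : 0 < k ^+ 2 by rewrite exprn_even_gt0.
have nk0 : 0 < `|k| by rewrite normr_gt0.
split.
  move=> [[p q] [[_ /= D0] /= p0]].
  have [cim0 cre0] := (Delta_eq0 q (prof_int prof) k0 p0).1 D0.
  by rewrite -cre0; apply: (profile_root_lt prof) => //; rewrite ?cre0// divr_gt0.
move=> /(profile_root_exists prof k2)[x [y [y0 cim0 cre0]]].
have p0 : 0 < y * `|k| by rewrite mulr_gt0.
(* Inverts z = i lambda / k: lambda is - i k z for positive [k], and - i k times the conjugate of z
   for negative [k]. *)
exists (Complex (y * `|k|) (- x * k)); split => //=; split; first by rewrite /= gt_eqF.
apply/(Delta_eq0 _ (prof_int prof) k0 p0).
have -> : - (- x * k) / k = x by field.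
by rewrite mulfK ?gt_eqF.
Qed.

End TwoPeaked.

Unset Implicit Arguments.

Theorem mainTheorem2 (R : realType) (f0 : R -> R) (a c b M k : R)
    (hf0 : distribution_function f0) (hpeaks : two_peaked f0 a c b M)
    (hk : k != 0)
    (hgeneric : forall s : R, f0^`() s = 0 -> penrose f0^`() k s != 0) :
  (Nplus f0^`() k = 1%N <->
     k ^+ 2 < \int[@lebesgue_measure R]_v (f0^`()%classic v / (v - c))) /\
  (Nplus f0^`() k = 1%N <->
     Lambda f0^`() k `&` [set lambda : R[i] | 0 < complex.Re lambda] !=set0).
Proof.
have hN := two_peaked_Nplus hf0 hpeaks hk.
by split; [exact: hN|rewrite hN; split; move/(two_peaked_Lambda hf0 hpeaks hk)].
Qed.
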